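(* Let $\mathbf X=(\xi_{jk}X_{jk})_{1\le j\le N,\,1\le k\le n}$ be the sparse random matrix described in the context, with $\mathbb E X_{jk}=0$ and $\mathbb E|X_{jk}|^2=1$. Suppose that for some $\delta>0$ there is a constant $\mu_{4+\delta}>0$ such that $\mathbb E|X_{jk}|^{4+\delta}\le \mu_{4+\delta}<\infty$ for all $j,k\ge1$. Put $\varkappa=\frac{\delta}{2(4+\delta)}$ and suppose that there exists a constant $B>0$ such that $Np\ge B(\log N)^{\frac{3}{2\varkappa}}$. In addition assume that there exists a constant $B'>0$ such that for every $N$ $$p=p_N\ge \frac{B'}{\ln^4 N}.$$ Then for every $Q\ge 1$ there exist constants $K$ and $C$, not depending on $N$, such that $$\Pr\{s_1\ge K\sqrt{Np}\}\le CN^{-Q}+\frac{C}{\ln^{\delta}N}.$$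
   Context: For integers $N>n\ge 1$ (so $N\ge2$), the $X_{jk}$ ($1\le j\le N$, $1\le k\le n$) are independent identically distributed real random variables with mean zero and $\mathbb E X_{jk}^2=1$; their common distribution may depend on $N$. They are independent of a family $\xi_{jk}$ ($1\le j\le N$, $1\le k\le n$) of independent Bernoulli ($\{0,1\}$-valued) random variables with $\mathbb E\xi_{jk}=p=p_N$. The matrix is $\mathbf X=(\xi_{jk}X_{jk})_{1\le j\le N,1\le k\le n}$, with singular values $s_1\ge\cdots\ge s_n$. Standing assumption: $n=n(N)$ and $n/N\to y_0\in(0,1)$ as $N\to\infty$; only the parameter $N$ is varied. Hypotheses are understood uniformly in $N$. *)

(* Defs.v *)
From HB Require Import structures.
From mathcomp Require Import all_boot all_order all_algebra.
From mathcomp Require Import all_classical all_reals all_analysis.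
From mathcomp Require Import spectral sesquilinear.
From mathcomp Require complex polyrcf.

Set Implicit Arguments.
Unset Strict Implicit.
Unset Printing Implicit Defensive.

Import Order.TTheory GRing.Theory Num.Theory.
Import numFieldNormedType.Exports.

Local Open Scope classical_set_scope.
Local Open Scope ring_scope.

(* The real eigenvalues, each repeated according to its algebraic
   multiplicity. *)
Definition eigenvalues (R : rcfType) (n : nat) (S : 'M[R]_n) : seq R :=
  flatten [seq nseq (mup x (char_poly S)) x
          | x <- polyrcf.rootsR (char_poly S)].

(* [(singular_values A)`_k] is s_(k+1) : the sequence is indexed from 0. *)
Definition singular_values (R : rcfType) (m n : nat) (A : 'M[R]_(m, n)) :
    seq R :=
  sort >=%R [seq Num.sqrt x | x <- eigenvalues (A^T *m A)].

Section spectrum_of_symmetric_matrix.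
Import complex.
Variable R : rcfType.
Let C : numClosedFieldType := complex.complex R.
Let toC : {rmorphism R -> C} := complex.real_complex R.

Lemma char_poly_conj (F : fieldType) (n : nat) (P D : 'M[F]_n) :
  P \in unitmx -> char_poly (invmx P *m D *m P) = char_poly D.
Proof.
move=> Pu; rewrite /char_poly.
pose Q := map_mx (@polyC F) P; pose Q' := map_mx (@polyC F) (invmx P).
have Q'Q : Q' *m Q = 1%:M by rewrite -map_mxM mulVmx// map_mx1.
have -> : char_poly_mx (invmx P *m D *m P) = Q' *m char_poly_mx D *m Q.
  rewrite /char_poly_mx mulmxBr mulmxBl !map_mxM; congr (_ - _).
  by rewrite -scalemx1 -scalemxAr mulmx1 -scalemxAl Q'Q.
by rewrite !det_mulmx mulrAC -det_mulmx Q'Q det1 mul1r.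
Qed.

Lemma char_poly_symmetric (n : nat) (S : 'M[R]_n) :
  S^T = S -> exists s : seq R, char_poly S = \prod_(x <- s) ('X - x%:P).
Proof.
move=> Ssym; pose A : 'M[C]_n := map_mx toC S.
have Areal : A \is a realmx.
  by apply/mxOverP => i j; rewrite mxE; apply/complex.complex_realP; eexists.
have Asym : A \is (@hermitianmx _ n false idfun).
  apply/is_hermitianmxP; rewrite expr0 scale1r.
  by apply/matrixP => i j; rewrite !mxE -[in LHS]Ssym mxE.
have Aherm := realsym_hermsym Asym Areal.
have /orthomx_spectralP AE := hermitian_normalmx Aherm.
have /mxOverP Dreal := hermitian_spectral_diag_real Aherm.
exists [seq complex.Re (spectral_diag A 0 i) | i <- enum 'I_n].
apply: (@map_poly_inj _ _ toC); rewrite map_char_poly -/A.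
rewrite [in LHS]AE char_poly_conj ?spectral_unit//.
rewrite char_poly_trig ?diag_mx_is_trig// big_map rmorph_prod/= big_enum/=.
apply: eq_bigr => i _; rewrite map_polyXsubC mxE eqxx mulr1n.
by congr (_ - _%:P); rewrite -[LHS]complex.RRe_real.
Qed.

Lemma char_poly_eigenvalues (n : nat) (S : 'M[R]_n) :
  S^T = S -> char_poly S = \prod_(x <- eigenvalues S) ('X - x%:P).
Proof.
move=> /char_poly_symmetric[s sE]; rewrite sE; apply: perm_big.
apply/allP => x _ /=; apply/eqP.
have p0 : char_poly S != 0 by rewrite monic_neq0// char_poly_monic.
have ur : uniq (polyrcf.rootsR (char_poly S)).
  exact: polyrcf.uniq_roots.
rewrite /eigenvalues count_flatten -map_comp.
have -> : count_mem x s = mup x (char_poly S) by rewrite sE mu_prod_XsubC.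
have [xr|xNr] := boolP (root (char_poly S) x); last first.
  rewrite mupNroot//; apply/esym/eqP; rewrite sumnE big_map big_seq big1// => y.
  move=> _; rewrite /= count_nseq/=; case: eqVneq => [->|]; last by rewrite mul0n.
  by rewrite mupNroot.
have xin : x \in polyrcf.rootsR (char_poly S).
  by rewrite -polyrcf.roots_on_rootsR// inE/=.
rewrite sumnE big_map (bigD1_seq x)//= count_nseq/= eqxx mul1n big1 ?addn0//.
by move=> y /negPf yx; rewrite count_nseq/= yx.
Qed.

End spectrum_of_symmetric_matrix.

Lemma char_poly_singular_values (R : rcfType) (m n : nat) (A : 'M[R]_(m, n)) :
  char_poly (A^T *m A) = \prod_(s <- singular_values A) ('X - (s ^+ 2)%:P).
Proof.
have Gsym : (A^T *m A)^T = A^T *m A by rewrite trmx_mul trmxK.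
rewrite /singular_values (perm_big _ (permEl (perm_sort _ _)))/= big_map.
rewrite {1}(char_poly_eigenvalues Gsym) big_seq [RHS]big_seq.
apply: eq_bigr => x xe; rewrite sqr_sqrtr//.
have : root (char_poly (A^T *m A)) x.
  by rewrite (char_poly_eigenvalues Gsym) root_prod_XsubC.
rewrite -eigenvalue_root_char => /eigenvalueP[v vE v0].
pose nn k (u : 'rV[R]_k) := (u *m u^T) 0 0.
have nnE k (u : 'rV[R]_k) : nn k u = \sum_i u 0 i ^+ 2.
  by rewrite /nn mxE; apply: eq_bigr => i _; rewrite mxE expr2.
have nn0 k (u : 'rV[R]_k) : 0 <= nn k u.
  by rewrite nnE sumr_ge0// => i _; exact: sqr_ge0.
have vv : 0 < nn n v.
  rewrite lt_def nn0 andbT nnE psumr_eq0; last by move=> i _; exact: sqr_ge0.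
  apply: contra v0 => /allP h; apply/eqP/rowP => i; rewrite mxE.
  by apply/eqP; have := h i (mem_index_enum _); rewrite /= sqrf_eq0.
have : nn m (v *m A^T) = x * nn n v.
  by rewrite /nn trmx_mul trmxK mulmxA -(mulmxA v) vE -scalemxAl mxE.
by move=> h; rewrite -(pmulr_lge0 _ vv) -h.
Qed.

Lemma size_singular_values (R : rcfType) (m n : nat) (A : 'M[R]_(m, n)) :
  size (singular_values A) = n.
Proof.
have := size_char_poly (A^T *m A).
by rewrite char_poly_singular_values size_prod_XsubC => -[].
Qed.

Section independence.
Context {d : measure_display} {T : measurableType d} {R : realType}.
Variable P : probability T R.

Definition mutually_independent (I : finType) (Y : I -> {RV P >-> R}) : Prop :=
  forall (J : {set I}) (B : I -> set R), (forall i, measurable (B i)) ->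
    P (\bigcap_(i in [set i | i \in J]) (Y i @^-1` B i)) =
    (\prod_(i in J) P (Y i @^-1` B i))%E.

Definition identically_distributed (I : Type) (Y : I -> {RV P >-> R}) : Prop :=
  forall (i i' : I) (B : set R), measurable B ->
    distribution P (Y i) B = distribution P (Y i') B.

Definition sigma_family (I : Type) (Y : I -> {RV P >-> R}) : set (set T) :=
  <<s [set E | exists i (B : set R), measurable B /\ E = Y i @^-1` B] >>.

Definition independent_families (I J : Type)
    (Y : I -> {RV P >-> R}) (Z : J -> {RV P >-> R}) : Prop :=
  forall E F, sigma_family Y E -> sigma_family Z F ->
    P (E `&` F) = (P E * P F)%E.

(* 'E_P is an extended-real integral: integrability of X i, needed for the
   mean to make sense, is a consequence of X_second_moment. *)
Record sparse_entries (N n : nat) (p : R)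
    (X xi : 'I_N * 'I_n -> {RV P >-> R}) : Prop := {
  X_independent : mutually_independent X ;
  X_identically_distributed : identically_distributed X ;
  X_mean : forall i, ('E_P[X i] = 0)%E ;
  X_second_moment : forall i, ('E_P[fun w => (X i w ^+ 2)%R] = 1)%E ;
  xi_independent : mutually_independent xi ;
  xi_01 : forall i w, xi i w = 0 \/ xi i w = 1 ;
  xi_mean : forall i, ('E_P[xi i] = p%:E)%E ;
  X_xi_independent : independent_families X xi
}.

Definition sparse_matrix (N n : nat) (X xi : 'I_N * 'I_n -> {RV P >-> R})
    (w : T) : 'M[R]_(N, n) :=
  \matrix_(j < N, k < n) (xi (j, k) w * X (j, k) w).

End independence.

(* Main.v *)
Require Import Defs.
From HB Require Import structures.
From mathcomp Require Import all_boot all_order all_algebra.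
From mathcomp Require Import all_classical all_reals all_analysis.
From mathcomp Require Import measurable_realfun ring lra.

Set Implicit Arguments.
Unset Strict Implicit.
Unset Printing Implicit Defensive.

Import Order.TTheory GRing.Theory Num.Theory.
Import numFieldNormedType.Exports.

(** Why the bound holds.  Put s = sqrt (N p).  It suffices to bound all forms
    x^T X y with x and y in the unit balls by a multiple of s, outside an event of
    probability at most N^(- c) for some c > 0: then the term (ln N)^(- delta)
    dominates for large N, and a large C takes care of the other values of N.
    All losses of powers of ln N, in particular those caused by a small p, are
    absorbed by small powers of N.

    Take H slightly below N^(1/2) and L = H^(1/3), slightly below N^(1/6).

    - By the moment of order 4 + delta no entry exceeds H, up to an event of
      probability N^(- c).  After rounding to multiples of 1/N, which moves the
      norm by at most 1, the entries take finitely many values and their joint law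
      is a finite product measure ([P_cell_array]), so that independence turns into
      distributivity of products over sums ([Ex_prod], [Ex_columns]).

    - The entries between L and H form an array whose rows and columns have small
      sums of absolute values: the means of these sums are of order N p L^(-3-delta),
      hence below s, and Chernoff's inequality applies because H ln N <= s
      ([line_sums_le]).  Schur's test bounds the norm of this part.

    - The entries below L, once centred, are treated by union bounds over grids.
      Split x and y into their coordinates larger than m^(- 1/2), at most m in
      number, and the other ones.  If both vectors have only small coordinates, no
      single term of the form is large and the variance governs its exponential
      moments, so that s is exceeded with probability exp (- c N), with a c that
      beats the exp (C N) points of the grid ([light_bform_le]).  If one of them
      has at most m nonzero coordinates, only N^(C m) vectors are to be
      considered, and the other vector is eliminated by the Cauchy-Schwarz
      inequality: what remains is a sum of independent squares, whose
      exponential moment at a parameter lam of order 1 / (L^2 ln N) is still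
      governed by the variance ([Ex_expR_sqr_var], [sparse_bform_le]).  The two
      requirements m ln N << lam N p and L N << m s are compatible since L^3 is
      below N^(1/2) by a power of N.

    The event in the theorem is measurable because s_1 < t can be read off the signs
    of finitely many polynomials in the entries ([singular_value_ltE]). *)

Local Open Scope ring_scope.

(** * Elementary exponential inequalities *)

Section exponential_inequalities.
Context {R : realType}.
Implicit Types x u : R.

(** Comes from exp x <= 1 / (1 - x), hence without derivatives, at the price of the
    factor 2 in front of x^2. *)
Lemma expR_le_quad x : x <= 2^-1 -> expR x <= 1 + x + 2 * x ^+ 2.
Proof.
move=> x2.
have d0 : 0 < 1 - x by lra.
have h : expR x <= (1 - x)^-1.
  by rewrite -[x]opprK expRN lef_pV2 ?posrE ?expR_gt0 ?opprK// expR_ge1Dx.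
apply: (le_trans h); rewrite -[leLHS]mul1r ler_pdivrMr//.
have : 0 <= x ^+ 2 * (1 - 2 * x) by apply: mulr_ge0; [exact: sqr_ge0|lra].
nra.
Qed.

Lemma expR_le_lin u : 0 <= u -> u <= 2^-1 -> expR u <= 1 + 2 * u.
Proof. by move=> u0 u2; have := expR_le_quad u2; nra. Qed.

(** Hoeffding's lemma with a poor constant: when |s| <= 1/2 the second order
    expansion suffices, and otherwise exp |s| is already below exp (2 s^2). *)
Lemma expR_mean_le (V : finType) (q Z : V -> R) s :
  (forall v, 0 <= q v) -> \sum_v q v = 1 -> \sum_v q v * Z v = 0 ->
  (forall v, `|Z v| <= 1) ->
  \sum_v q v * expR (s * Z v) <= expR (2 * s ^+ 2).
Proof.
move=> q0 q1 qZ Z1.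
have Z2 v : Z v ^+ 2 <= 1 by rewrite -[leLHS]real_normK ?num_real// expr_le1.
have sZ v : s * Z v <= `|s|.
  by rewrite (le_trans (ler_norm _))// normrM ler_piMr.
have [s2|s2] := leP `|s| 2^-1; last first.
  apply: (@le_trans _ _ (\sum_v q v * expR (2 * s ^+ 2))); last first.
    by rewrite -mulr_suml q1 mul1r.
  apply: ler_sum => v _; apply: ler_wpM2l => //; rewrite ler_expR.
  apply: (le_trans (sZ v)).
  by rewrite -[s ^+ 2]real_normK ?num_real//; nra.
apply: (@le_trans _ _ (1 + 2 * s ^+ 2)); last exact: expR_ge1Dx.
apply: (@le_trans _ _ (\sum_v (q v + s * (q v * Z v) + q v * (2 * s ^+ 2)))).
  apply: ler_sum => v _.
  have := expR_le_quad (le_trans (sZ v) s2).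
  have := q0 v; have := Z2 v; have := sqr_ge0 s.
  move=> s20 zv qv h.
  have h2 : expR (s * Z v) <= 1 + s * Z v + 2 * s ^+ 2.
    by apply: (le_trans h); rewrite exprMn lerD2l ler_wpM2l// ler_piMr.
  have := ler_wpM2l qv h2; nra.
by rewrite !big_split/= -mulr_sumr -mulr_suml q1 qZ mulr0 addr0 mul1r.
Qed.

End exponential_inequalities.

(** * Product measures on finite spaces *)

Section product_expectation.
Context {R : realType} {V : finType} (q : V -> R).

Definition Ex (I : finType) (F : {ffun I -> V} -> R) : R :=
  \sum_(w : {ffun I -> V}) (\prod_i q (w i)) * F w.

Lemma eq_Ex (I : finType) (F G : {ffun I -> V} -> R) : F =1 G -> Ex F = Ex G.
Proof. by move=> FG; apply: eq_bigr => w _; rewrite FG. Qed.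

Lemma Ex_prod (I : finType) (f : I -> V -> R) :
  Ex (fun w => \prod_i f i (w i)) = \prod_i \sum_v q v * f i v.
Proof.
rewrite bigA_distr_bigA/=; apply: eq_bigr => w _.
by rewrite big_split.
Qed.

Lemma Ex_sum (I K : finType) (F : K -> {ffun I -> V} -> R) :
  Ex (fun w => \sum_k F k w) = \sum_k Ex (F k).
Proof. by rewrite exchange_big/=; apply: eq_bigr => w _; rewrite mulr_sumr. Qed.

Lemma ExD (I : finType) (F G : {ffun I -> V} -> R) :
  Ex (fun w => F w + G w) = Ex F + Ex G.
Proof. by rewrite -big_split/=; apply: eq_bigr => w _; rewrite mulrDr. Qed.

Lemma ExZ (I : finType) c (F : {ffun I -> V} -> R) :
  Ex (fun w => c * F w) = c * Ex F.
Proof. by rewrite mulr_sumr; apply: eq_bigr => w _; rewrite mulrCA. Qed.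

Lemma Ex_reindex (I J : finType) (g : J -> I) (g' : I -> J)
    (F : {ffun J -> V} -> R) : cancel g g' -> cancel g' g ->
  Ex F = Ex (fun w : {ffun I -> V} => F [ffun j => w (g j)]).
Proof.
move=> gK g'K.
rewrite /Ex (reindex (fun w : {ffun I -> V} => [ffun j => w (g j)])) /=.
  apply: eq_bigr => w _; congr (_ * _).
  rewrite [RHS](reindex g)/=; first by apply: eq_bigr => j _; rewrite ffunE.
  by exists g' => ? _; [exact: gK|exact: g'K].
exists (fun w : {ffun J -> V} => [ffun i => w (g' i)]) => w _.
  by apply/ffunP => i; rewrite !ffunE g'K.
by apply/ffunP => i; rewrite !ffunE gK.
Qed.

(** Independence of the columns: the weight of an array is the product of the
    weights of its columns, and an array is a family of columns. *)
Lemma Ex_columns (I J : finType) (G : J -> {ffun I -> V} -> R) :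
  Ex (fun w : {ffun I * J -> V} => \prod_j G j [ffun i => w (i, j)]) =
  \prod_j Ex (G j).
Proof.
rewrite bigA_distr_bigA/=.
rewrite (reindex (fun w : {ffun I * J -> V} => [ffun j => [ffun i => w (i, j)]]))/=.
  apply: eq_bigr => w _; rewrite big_split/=; congr (_ * _); last first.
    by apply: eq_bigr => j _; rewrite ffunE.
  rewrite exchange_big/= pair_bigA/=; apply: eq_bigr => -[i j] _ /=.
  by rewrite !ffunE.
exists (fun u : {ffun J -> {ffun I -> V}} => [ffun ij => u ij.2 ij.1]) => w _.
  by apply/ffunP => -[i j]; rewrite !ffunE.
by apply/ffunP => j; apply/ffunP => i; rewrite !ffunE.
Qed.

Hypothesis q0 : forall v, 0 <= q v.
Hypothesis q1 : \sum_v q v = 1.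

Lemma ler_Ex (I : finType) (F G : {ffun I -> V} -> R) :
  (forall w, F w <= G w) -> Ex F <= Ex G.
Proof.
move=> FG; apply: ler_sum => w _; apply: ler_wpM2l => //.
exact: prodr_ge0.
Qed.

Lemma Ex_ge0 (I : finType) (F : {ffun I -> V} -> R) :
  (forall w, 0 <= F w) -> 0 <= Ex F.
Proof. by move=> F0; apply: sumr_ge0 => w _; apply: mulr_ge0 => //; exact: prodr_ge0. Qed.

Lemma Ex_cst (I : finType) c : Ex (fun _ : {ffun I -> V} => c) = c.
Proof.
transitivity (c * Ex (fun w : {ffun I -> V} => \prod_(i : I) (fun _ => 1) (w i))).
  by rewrite -ExZ; apply: eq_Ex => w; rewrite big1 ?mulr1.
rewrite (Ex_prod (fun _ _ => 1)) big1 ?mulr1// => i _.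
by under eq_bigr do rewrite mulr1.
Qed.

Definition Pr (I : finType) (E : pred {ffun I -> V}) : R :=
  Ex (fun w => (E w)%:R).

Lemma Pr_le_Ex (I : finType) (E : pred {ffun I -> V}) F :
  (forall w, 0 <= F w) -> (forall w, E w -> 1 <= F w) -> Pr E <= Ex F.
Proof.
by move=> F0 F1; apply: ler_Ex => w; case: (boolP (E w)) => [/F1|_].
Qed.

Lemma Pr_union_le (I K : finType) (A : pred K) (E : K -> pred {ffun I -> V}) :
  Pr (fun w => [exists (k | A k), E k w]) <= \sum_(k | A k) Pr (E k).
Proof.
rewrite big_mkcond/=.
apply: (@le_trans _ _ (Ex (fun w => \sum_k (if A k then (E k w)%:R else 0)))).
  apply: Pr_le_Ex => w.
    by apply: sumr_ge0 => k _; case: ifP.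
  move=> /existsP[k /andP[Ak Ek]].
  rewrite (bigD1 k)//= Ak Ek lerDl; apply: sumr_ge0 => j _; by case: ifP.
rewrite Ex_sum le_eqVlt; apply/orP; left; apply/eqP; apply: eq_bigr => k _.
by case: ifP => // _; rewrite Ex_cst.
Qed.

Lemma PrU (I : finType) (E E' : pred {ffun I -> V}) :
  Pr (fun w => E w || E' w) <= Pr E + Pr E'.
Proof.
rewrite -ExD; apply: ler_Ex => w.
by case: (E w) (E' w) => -[] /=; rewrite -?natrD ?ler_nat.
Qed.

(** Markov's inequality for exp F, the only source of small probabilities in the
    union bounds. *)
Lemma Pr_expR (I : finType) (F : {ffun I -> V} -> R) (E : pred {ffun I -> V}) t b :
  (forall w, E w -> t <= F w) -> Ex (fun w => expR (F w)) <= b ->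
  Pr E <= b * expR (- t).
Proof.
move=> EF Fb.
apply: (@le_trans _ _ (Ex (fun w => expR (- t) * expR (F w)))).
  apply: Pr_le_Ex => w; first by rewrite mulr_ge0 ?expR_ge0.
  by move=> /EF h; rewrite -expRD addrC -expR0 ler_expR subr_ge0.
by rewrite ExZ mulrC ler_wpM2r ?expR_ge0.
Qed.

End product_expectation.

(** * Integer grids in the unit ball *)

Section lattice.
Context {R : realType}.

(** The integers from -M to M, indexed by a finite type so that the grids are
    finite sets and sums over them factor. *)
Definition centered (M : nat) (i : 'I_(M + M.+1)) : R := i%:R - M%:R.

(** Rounding goes towards 0 because it must preserve the bounds imposed on the
    coordinates. *)
Lemma round_to_zero M (x : R) : `|x| <= M%:R ->
  exists i, `|@centered M i| <= `|x| /\ `|x - centered i| <= 1.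
Proof.
move=> xM; have /andP[kx xk] := truncn_itv (normr_ge0 x).
set k := Num.truncn `|x| in kx xk *.
have kM : (k <= M)%N by rewrite -(ler_nat R) (le_trans kx).
rewrite -natr1 in xk.
have [x0|x0] := leP 0 x.
  have h : (M + k < M + M.+1)%N by rewrite ltn_add2l ltnS.
  exists (Ordinal h); rewrite /centered/= natrD addrAC subrr add0r.
  rewrite [`|k%:R|]ger0_norm ?ler0n//; split => //.
  rewrite ger0_norm// in kx xk.
  rewrite ler_norml; apply/andP; split; lra.
have h : (M - k < M + M.+1)%N by rewrite (leq_ltn_trans (leq_subr _ _))// -addSnnS leq_addr.
exists (Ordinal h); rewrite /centered/= natrB// addrAC subrr add0r normrN.
rewrite [`|k%:R|]ger0_norm ?ler0n//; split => //.
rewrite ltr0_norm// in kx xk.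
rewrite ler_norml; apply/andP; split; lra.
Qed.

Lemma theta_sum_half (r : R) n : 0 <= r -> r <= 2^-1 ->
  \sum_(k < n) r ^+ k.+1 <= 2 * r.
Proof.
move=> r0 r2.
have h : \sum_(k < n) r ^+ k.+1 = r * \sum_(k < n) r ^+ k.
  by rewrite mulr_sumr; apply: eq_bigr => k _; rewrite exprS.
rewrite h mulrC ler_wpM2r//.
have := subrX1 r n; have := exprn_ge0 n r0.
set S := \sum_(_ < _) _; have S0 : 0 <= S by apply: sumr_ge0 => k _; exact: exprn_ge0.
nra.
Qed.

(** Replacing k^2 by |k| bounds the theta series by two geometric series of ratio
    exp (- th) <= 1/2. *)
Lemma theta_sum th M : 2 <= expR th ->
  \sum_i expR (- th * @centered M i ^+ 2) <= 1 + 4 * expR (- th).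
Proof.
move=> th2; set r := expR (- th).
have r0 : 0 <= r := expR_ge0 _.
have r2 : r <= 2^-1 by rewrite /r expRN lef_pV2// posrE ?expR_gt0//.
have term n : expR (- th * n.+1%:R ^+ 2) <= r ^+ n.+1.
  rewrite -natrX -expRM_natr ler_expR !mulNr lerN2 ler_wpM2l//.
    by rewrite -ler_expR expR0 (le_trans _ th2)// lerDl.
  by rewrite ler_nat expnS expn1 leq_pmulr.
rewrite big_split_ord/= big_ord_recl/=.
have -> : 1 + 4 * r = 2 * r + (1 + 2 * r) by ring.
apply: lerD; last apply: lerD.
- rewrite (reindex_inj rev_ord_inj)/= (le_trans _ (@theta_sum_half r M _ _))//.
  apply: ler_sum => k _; apply: le_trans (term k).
  rewrite /centered/= natrB ?ltn_ord// addrAC subrr add0r sqrrN//.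
- by rewrite /centered/= addn0 subrr expr0n/= mulr0 expR0.
- rewrite (le_trans _ (@theta_sum_half r M _ _))//.
  apply: ler_sum => k _; apply: le_trans (term k).
  by rewrite /centered/= natrD addrAC subrr add0r /bump/= add1n.
Qed.

Definition lattice (I : finType) (M : nat) (S : R) :
    {set {ffun I -> 'I_(M + M.+1)}} :=
  [set z : {ffun I -> _} | \sum_i centered (z i) ^+ 2 <= S].

(** Weight z by exp (- th |z|^2): the total mass factors over the coordinates, and
    each point of the grid has mass at least exp (- th S).  The choice th = 1 suits
    S of the order of the dimension; for S much smaller, th = ln N makes the second
    term in the exponent bounded. *)
Lemma card_lattice (I : finType) M th (S : R) : 2 <= expR th ->
  (#|lattice I M S|%:R : R) <= expR (th * S + 4 * expR (- th) * #|I|%:R).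
Proof.
move=> th2.
have th0 : 0 <= th by rewrite -ler_expR expR0 (le_trans _ th2)// lerDl.
rewrite expRD.
apply: (@le_trans _ _ (\sum_(z in lattice I M S)
   expR (th * S) * \prod_i expR (- th * @centered M (z i) ^+ 2))).
  rewrite -sum1_card natr_sum; apply: ler_sum => z; rewrite inE => zS.
  rewrite -expR_sum -expRD -expR0 ler_expR -mulr_sumr mulNr -mulrBr.
  by rewrite mulr_ge0// subr_ge0.
rewrite -mulr_sumr ler_wpM2l ?expR_ge0//.
apply: (@le_trans _ _ (\sum_(z : {ffun I -> _}) \prod_(i : I) expR (- th * @centered M (z i) ^+ 2))).
  rewrite [leLHS]big_mkcond/=; apply: ler_sum => z _; case: ifP => // _.
  by apply: prodr_ge0 => i _; exact: expR_ge0.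
rewrite -(bigA_distr_bigA (fun (i : I) k => expR (- th * @centered M k ^+ 2))).
rewrite prodr_const expRM_natr lerXn2r ?nnegrE ?expR_ge0//.
  by apply: sumr_ge0 => i _; exact: expR_ge0.
by rewrite (le_trans (theta_sum _ th2))// expR_ge1Dx.
Qed.

(** Rounding a vector of the domain towards 0 on the grid of mesh h leaves a
    remainder whose double r is again in the domain, so that the supremum S of the
    form satisfies S <= T + S / 2.  The bounds tau serve both for vectors with a
    given support (tau is 1 on it and 0 elsewhere) and for vectors with small
    coordinates (tau is constant). *)
Lemma linear_form_net (I : finType) (f tau : I -> R) (h T : R) M :
  0 < h -> 1 <= h * M%:R -> 4 * h ^+ 2 * #|[pred i | tau i != 0]|%:R <= 1 ->
  (forall i, tau i != 0 -> 2 * h <= tau i) ->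
  (forall z : {ffun I -> 'I_(M + M.+1)}, z \in lattice I M (h ^- 2) ->
     (forall i, h * `|@centered M (z i)| <= tau i) ->
     \sum_i h * centered (z i) * f i <= T) ->
  forall x : I -> R, \sum_i x i ^+ 2 <= 1 -> (forall i, `|x i| <= tau i) ->
  \sum_i x i * f i <= 2 * T.
Proof.
move=> h0 hM htau tau2h netT.
have step (x : I -> R) : \sum_i x i ^+ 2 <= 1 -> (forall i, `|x i| <= tau i) ->
  exists r : I -> R, [/\ \sum_i r i ^+ 2 <= 1, (forall i, `|r i| <= tau i) &
    \sum_i x i * f i <= T + 2^-1 * \sum_i r i * f i].
  move=> x1 xtau.
  have tau0 i : 0 <= tau i by apply: le_trans (xtau i).
  have xle1 i : `|x i| <= 1.
    rewrite -(@ler_pXn2r _ 2)// ?nnegrE// expr1n real_normK ?num_real//.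
    by rewrite (le_trans _ x1)// (bigD1 i)//= lerDl sumr_ge0// => j _; exact: sqr_ge0.
  have rnd i : exists k, `|@centered M k| <= `|x i / h| /\ `|x i / h - centered k| <= 1.
    apply: round_to_zero; rewrite normrM normfV (gtr0_norm h0) ler_pdivrMr// mulrC.
    exact: le_trans (xle1 i) hM.
  pose z := [ffun i => projT1 (cid (rnd i))].
  have zx i : h * `|@centered M (z i)| <= `|x i|.
    rewrite ffunE; case: (cid _) => k [/= h1 _].
    by rewrite mulrC -ler_pdivlMr// (le_trans h1)// normrM normfV (gtr0_norm h0).
  have xz i : `|x i - h * centered (z i)| <= h.
    rewrite ffunE; case: (cid _) => k [/= _ h2].
    have -> : x i - h * centered k = h * (x i / h - centered k).
      by field; rewrite gt_eqF.
    by rewrite normrM (gtr0_norm h0) ler_piMr// ltW.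
  pose r i := 2 * (x i - h * centered (z i)).
  have r_small i : `|r i| <= 2 * h by rewrite normrM ger0_norm// ler_pM2l.
  have r0 i : tau i = 0 -> r i = 0.
    move=> ti; have xi : x i = 0.
      by apply/eqP; rewrite -normr_le0 -ti.
    have : h * `|@centered M (z i)| <= 0 by rewrite (le_trans (zx i))// xi normr0.
    rewrite pmulr_rle0// normr_le0 => /eqP zi.
    by rewrite /r xi zi mulr0 subrr mulr0.
  exists r; split.
  - rewrite (le_trans _ htau)// [leLHS](bigID (fun i => tau i != 0))/= addrC.
    rewrite big1 => [|i /negPn/eqP/r0 ->]; last by rewrite expr0n.
    rewrite add0r -sum1_card natr_sum mulr_sumr; apply: ler_sum => i _.
    rewrite mulr1 -[leLHS]real_normK ?num_real// (_ : 4 = 2 ^+ 2); last by ring.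
    by rewrite -exprMn lerXn2r ?nnegrE ?normr_ge0// mulr_ge0// ltW.
  - move=> i; have [ti|ti] := eqVneq (tau i) 0; first by rewrite r0// normr0.
    exact: le_trans (r_small i) (tau2h _ ti).
  - have -> : \sum_i x i * f i = \sum_i h * centered (z i) * f i + 2^-1 * \sum_i r i * f i.
      rewrite mulr_sumr -big_split/=; apply: eq_bigr => i _.
      by rewrite /r; field.
    rewrite lerD2r; apply: netT => [|i]; last exact: le_trans (zx i) (xtau i).
    rewrite inE -(ler_pM2l (exprn_gt0 2 h0)) divff ?expf_neq0 ?gt_eqF//.
    rewrite (le_trans _ x1)// mulr_sumr; apply: ler_sum => i _.
    rewrite -exprMn -real_normK ?num_real// -[leRHS]real_normK ?num_real//.
    by rewrite lerXn2r ?nnegrE ?normr_ge0// normrM (gtr0_norm h0).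
move=> x x1 xtau.
pose F := \sum_i `|f i|.
have crude (y : I -> R) : \sum_i y i ^+ 2 <= 1 -> \sum_i y i * f i <= F.
  move=> y1; apply: ler_sum => i _; rewrite (le_trans (ler_norm _))// normrM.
  rewrite ler_piMl// -(@ler_pXn2r _ 2)// ?nnegrE// expr1n real_normK ?num_real//.
  by rewrite (le_trans _ y1)// (bigD1 i)//= lerDl sumr_ge0// => j _; exact: sqr_ge0.
(* Iterating the previous step k times avoids speaking of the supremum. *)
have geo k (y : I -> R) : \sum_i y i ^+ 2 <= 1 -> (forall i, `|y i| <= tau i) ->
    \sum_i y i * f i <= 2 * T + 2^-1 ^+ k * (F - 2 * T).
  elim: k y => [|k IH] y y1 ytau.
    by rewrite expr0 mul1r addrCA subrr addr0 crude.
  have [r [r1 rtau h1]] := step y y1 ytau.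
  have := IH r r1 rtau; rewrite exprS; move: h1; set A := \sum_i _; set B := \sum_i _.
  lra.
rewrite leNgt; apply/negP => lt.
set A := \sum_i _ in lt.
have FA : A <= F by exact: crude.
have D0 : 0 < F - 2 * T by lra.
set e := A - 2 * T; have e0 : 0 < e by rewrite /e; lra.
have := geo (Num.truncn ((F - 2 * T) / e)).+1 x x1 xtau; rewrite -/A.
set n := (Num.truncn _).
have n1 : (F - 2 * T) / e < n.+1%:R by exact: truncnS_gt.
rewrite ltr_pdivrMr// in n1.
have n2 : (n.+1%:R : R) <= 2 ^+ n.+1 by rewrite -natrX ler_nat ltnW// ltn_expl.
have : (F - 2 * T) < 2 ^+ n.+1 * e by apply: (lt_le_trans n1); rewrite ler_wpM2r// ltW.
rewrite -ltr_pdivrMl ?exprn_gt0// -exprVn /e => h2 h3.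
lra.
Qed.

End lattice.

(** * Exponential moments of linear forms *)

Section sub_gaussian.
Context {R : realType} {V : finType} (q : V -> R).
Hypothesis q0 : forall v, 0 <= q v.
Hypothesis q1 : \sum_v q v = 1.

Lemma Ex_expR_linear (I : finType) (x : I -> R) (Z : V -> R) (s : R) :
  \sum_v q v * Z v = 0 -> (forall v, `|Z v| <= 1) ->
  Ex q (fun w : {ffun I -> V} => expR (s * \sum_i x i * Z (w i))) <=
  expR (2 * s ^+ 2 * \sum_i x i ^+ 2).
Proof.
move=> qZ Z1.
pose f i v := expR (s * x i * Z v).
rewrite (@eq_Ex _ _ _ _ _ (fun w : {ffun I -> V} => \prod_i f i (w i))); last first.
  by move=> w; rewrite -expR_sum mulr_sumr; congr expR; apply: eq_bigr => i _; rewrite mulrA.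
rewrite Ex_prod mulr_sumr expR_sum; apply: ler_prod => i _.
rewrite sumr_ge0/= => [|v _]; last by rewrite mulr_ge0 ?expR_ge0.
by rewrite (le_trans (expR_mean_le _ q0 q1 qZ Z1))// exprMn mulrA.
Qed.

(** A discrete substitute for the Gaussian identity
    exp (u^2/2) = E exp (g u): completing the square, the integer i nearest to
    u/6 gives -3 i^2 + i u >= u^2/12 - 3. *)
Lemma expR_sqr_le_sum M (u : R) : `|u / 6| <= M%:R ->
  expR (u ^+ 2 / 12) <=
  expR 3 * \sum_i expR (- 3 * @centered R M i ^+ 2 + centered i * u).
Proof.
move=> uM; have [k [_ k1]] := round_to_zero uM.
rewrite (bigD1 k)//= mulrDr ler_wpDr//.
  by rewrite mulr_ge0 ?expR_ge0// sumr_ge0// => i _; exact: expR_ge0.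
rewrite -expRD ler_expR; set c := centered k in k1 *.
have : (u / 6 - c) ^+ 2 <= 1 by rewrite -[leLHS]real_normK ?num_real// expr_le1.
nra.
Qed.

(** The Gaussian-like sum of [expR_sqr_le_sum] turns the square in the exponent into
    linear forms, to which the sub-Gaussian bound applies term by term. *)
Lemma Ex_expR_sqr (I : finType) (x : I -> R) (Z : V -> R) (k : R) :
  \sum_v q v * Z v = 0 -> (forall v, `|Z v| <= 1) -> \sum_i x i ^+ 2 <= 1 ->
  k <= 12^-1 ->
  Ex q (fun w : {ffun I -> V} => expR (k * (\sum_i x i * Z (w i)) ^+ 2)) <=
  3 * expR 3.
Proof.
move=> qZ Z1 x1 k12.
pose M := (Num.truncn (\sum_i `|x i|)).+1.
have UM (w : {ffun I -> V}) : `|(\sum_i x i * Z (w i)) / 6| <= M%:R.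
  rewrite normrM (@le_trans _ _ (\sum_i `|x i|))//; last exact/ltW/truncnS_gt.
  rewrite [X in _ * X]ger0_norm ?invr_ge0// ler_pdivrMr//.
  apply: (@le_trans _ _ (\sum_i `|x i|)).
    rewrite (le_trans (ler_norm_sum _ _ _))//; apply: ler_sum => i _.
    by rewrite normrM ler_piMr.
  by rewrite ler_peMr// ?sumr_ge0// (ler_nat _ 1 6).
apply: (@le_trans _ _ (Ex q (fun w => expR 3 * \sum_i
    (expR (- 3 * @centered R M i ^+ 2) * expR (centered i * \sum_j x j * Z (w j)))))).
  apply: ler_Ex => // w.
  apply: le_trans (_ : expR ((\sum_i x i * Z (w i)) ^+ 2 / 12) <= _).
    by rewrite ler_expR mulrC ler_wpM2l// sqr_ge0.
  apply: (le_trans (expR_sqr_le_sum (UM w))).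
  by under eq_bigr do rewrite expRD.
rewrite ExZ mulrC ler_wpM2r ?expR_ge0//.
rewrite Ex_sum.
apply: (@le_trans _ _ (\sum_i expR (- 1 * @centered R M i ^+ 2))).
  apply: ler_sum => i _; rewrite ExZ.
  have h := Ex_expR_linear x (centered i) qZ Z1.
  apply: (@le_trans _ _ (expR (- 3 * @centered R M i ^+ 2) * expR (2 * centered i ^+ 2 * 1))).
    rewrite ler_wpM2l ?expR_ge0// (le_trans h)// ler_expR ler_wpM2l//.
    by rewrite mulr_ge0// sqr_ge0.
  by rewrite -expRD ler_expR; lra.
have e2 : 2 <= expR 1 :> R by exact: le_trans (expR_ge1Dx 1).
rewrite (le_trans (theta_sum M e2))//.
have : expR (- 1) <= 2^-1 :> R by rewrite expRN lef_pV2// posrE ?expR_gt0.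
lra.
Qed.

(** The covariances vanish. *)
Lemma Ex_sqr (I : finType) (x : I -> R) (a : V -> R) :
  \sum_v q v * a v = 0 ->
  Ex q (fun w : {ffun I -> V} => (\sum_i x i * a (w i)) ^+ 2) =
  (\sum_v q v * a v ^+ 2) * \sum_i x i ^+ 2.
Proof.
move=> qa.
have cov (i j : I) : Ex q (fun w : {ffun I -> V} => a (w i) * a (w j)) =
    if i == j then \sum_v q v * a v ^+ 2 else 0.
  pose f k v : R := (if k == i then a v else 1) * (if k == j then a v else 1).
  rewrite (@eq_Ex _ _ _ _ _ (fun w : {ffun I -> V} => \prod_k f k (w k))); last first.
    move=> w; have one i0 : \prod_k (if k == i0 then a (w k) else 1) = a (w i0).
      by rewrite (bigD1 i0)//= eqxx big1 ?mulr1// => k /negPf ->.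
    by rewrite /f big_split/= !one.
  rewrite Ex_prod (bigD1 i)//=.
  rewrite {1}/f; have [ij|ij] := eqVneq i j; last first.
    rewrite eqxx; under eq_bigr do rewrite mulr1.
    by rewrite qa mul0r.
  rewrite eqxx [X in _ * X]big1 ?mulr1; last first.
    move=> k /negPf ki; transitivity (\sum_v q v) => //; apply: eq_bigr => v _.
    by rewrite /f -ij ki !mulr1.
  by apply: eq_bigr => v _; rewrite expr2.
transitivity (Ex q (fun w : {ffun I -> V} => \sum_i \sum_j x i * x j * (a (w i) * a (w j)))).
  apply: eq_Ex => w; rewrite expr2 mulr_suml; apply: eq_bigr => i _.
  by rewrite mulr_sumr; apply: eq_bigr => j _; ring.
rewrite Ex_sum mulr_sumr; apply: eq_bigr => i _.
rewrite Ex_sum (bigD1 i)//= big1 ?addr0 => [|j ji].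
  by rewrite ExZ [X in _ * X]cov eqxx -expr2 mulrC.
by rewrite ExZ [X in _ * X]cov eq_sym (negPf ji) mulr0.
Qed.

(** Below u = 1/2 use the linear bound of exp, whose mean is governed by the
    variance; above it, exp u <= exp (- M) exp ((2 M + 1) u) moves the rare
    large values into the sub-Gaussian bound at the price of a factor
    exp (- M). *)
Lemma Ex_expR_sqr_var (I : finType) (x : I -> R) (a : V -> R) (D v lam M : R) :
  \sum_v q v * a v = 0 -> 0 < D -> (forall v, `|a v| <= D) ->
  \sum_v q v * a v ^+ 2 <= v -> \sum_i x i ^+ 2 <= 1 ->
  0 <= lam -> 0 <= M -> 12 * (2 * M + 1) * lam * D ^+ 2 <= 1 ->
  Ex q (fun w : {ffun I -> V} => expR (lam * (\sum_i x i * a (w i)) ^+ 2)) <=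
  1 + 2 * lam * v + 3 * expR (3 - M).
Proof.
move=> qa D0 aD av x1 lam0 M0 hM.
pose Z t := a t / D.
have qZ : \sum_t q t * Z t = 0.
  by under eq_bigr do rewrite mulrA; rewrite -mulr_suml qa mul0r.
have Z1 t : `|Z t| <= 1.
  by rewrite normrM normfV (gtr0_norm D0) ler_pdivrMr// mul1r.
have WZ (w : {ffun I -> V}) : \sum_i x i * a (w i) = D * \sum_i x i * Z (w i).
  rewrite mulr_sumr; apply: eq_bigr => i _; rewrite /Z; field.
  by rewrite gt_eqF.
have k12 : (2 * M + 1) * lam * D ^+ 2 <= 12^-1 by lra.
have bound := Ex_expR_sqr qZ Z1 x1 k12.
apply: (@le_trans _ _ (Ex q (fun w : {ffun I -> V} =>
   1 + (2 * lam * (\sum_i x i * a (w i)) ^+ 2 +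
   expR (- M) * expR ((2 * M + 1) * lam * D ^+ 2 * (\sum_i x i * Z (w i)) ^+ 2))))).
  apply: ler_Ex => // w; set W := \sum_i x i * a (w i).
  have -> : (2 * M + 1) * lam * D ^+ 2 * (\sum_i x i * Z (w i)) ^+ 2 =
      (2 * M + 1) * (lam * W ^+ 2) by rewrite /W WZ; ring.
  rewrite -mulrA; set u := lam * W ^+ 2.
  have u0 : 0 <= u by rewrite mulr_ge0// sqr_ge0.
  have [u2|u2] := leP u 2^-1.
    rewrite addrA ler_wpDr ?expR_le_lin// mulr_ge0 ?expR_ge0//.
  rewrite -expRD ler_wpDl//; apply: ler_wpDl; first by lra.
  by rewrite ler_expR; nra.
rewrite ExD Ex_cst// ExD !ExZ -addrA lerD2l; apply: lerD.
  rewrite ler_wpM2l ?mulr_ge0//.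
  have -> := Ex_sqr x qa.
  have a20 : 0 <= \sum_v q v * a v ^+ 2.
    by apply: sumr_ge0 => t _; rewrite mulr_ge0// sqr_ge0.
  by rewrite (le_trans _ av)// ler_piMr.
have -> : 3 * expR (3 - M) = expR (- M) * (3 * expR 3) by rewrite expRD; ring.
by rewrite ler_wpM2l ?expR_ge0.
Qed.

(** The second moment controls the exponential moment as long as the exponent
    stays below 1/2. *)
Lemma Ex_expR_bilinear (I : finType) (c : I -> R) (a : V -> R) (v lam : R) :
  \sum_v q v * a v = 0 -> \sum_v q v * a v ^+ 2 <= v ->
  (forall i t, lam * (c i * a t) <= 2^-1) ->
  Ex q (fun w : {ffun I -> V} => expR (lam * \sum_i c i * a (w i))) <=
  expR (2 * lam ^+ 2 * v * \sum_i c i ^+ 2).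
Proof.
move=> qa av small.
pose f i t := expR (lam * (c i * a t)).
rewrite (@eq_Ex _ _ _ _ _ (fun w : {ffun I -> V} => \prod_i f i (w i))); last first.
  by move=> w; rewrite -expR_sum mulr_sumr.
rewrite Ex_prod mulr_sumr expR_sum; apply: ler_prod => i _.
rewrite sumr_ge0/= => [|t _]; last by rewrite mulr_ge0 ?expR_ge0.
apply: le_trans (expR_ge1Dx _).
apply: (@le_trans _ _ (\sum_t (q t + lam * c i * (q t * a t) +
    2 * lam ^+ 2 * c i ^+ 2 * (q t * a t ^+ 2)))).
  apply: ler_sum => t _.
  have := ler_wpM2l (q0 t) (expR_le_quad (small i t)).
  by move=> h; apply: (le_trans h); rewrite le_eqVlt; apply/orP; left; apply/eqP; ring.
rewrite !big_split/= -!mulr_sumr q1 qa mulr0 addr0 lerD2l.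
have -> : 2 * lam ^+ 2 * v * c i ^+ 2 = 2 * lam ^+ 2 * c i ^+ 2 * v by ring.
by rewrite ler_wpM2l// mulr_ge0 ?sqr_ge0// mulr_ge0 ?sqr_ge0.
Qed.

(** For nonnegative terms the mean alone controls exp (th b) as long as
    th b <= 1/2, where the exponential is below 1 + 2 th b. *)
Lemma Pr_sum_ge (I : finType) (A : pred I) (b : V -> R) (th t : R) : 0 <= th ->
  (forall v, 0 <= th * b v <= 2^-1) ->
  Pr q (fun w : {ffun I -> V} => t <= \sum_(i | A i) b (w i)) <=
  expR (2 * th * (\sum_v q v * b v) * #|A|%:R - th * t).
Proof.
move=> th0 b2; rewrite expRD.
apply: (Pr_expR q0 (F := fun w : {ffun I -> V} => th * \sum_(i | A i) b (w i))).
  by move=> w; exact: ler_wpM2l.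
pose f (i : I) t := if A i then expR (th * b t) else 1.
rewrite (@eq_Ex _ _ _ _ _ (fun w : {ffun I -> V} => \prod_i f i (w i))); last first.
  by move=> w; rewrite /f -big_mkcond/= -expR_sum mulr_sumr.
rewrite Ex_prod expRM_natr -prodr_const [leRHS]big_mkcond/=; apply: ler_prod => i _.
rewrite /f unfold_in; case: (A i); last first.
  by under eq_bigr do rewrite mulr1; rewrite q1 ler01 lexx.
rewrite sumr_ge0/= => [|v _]; last by rewrite mulr_ge0 ?expR_ge0.
apply: le_trans (expR_ge1Dx _).
apply: (@le_trans _ _ (\sum_v (q v + 2 * th * (q v * b v)))).
  apply: ler_sum => v _; have /andP[b0 b1] := b2 v.
  have := ler_wpM2l (q0 v) (expR_le_lin b0 b1).
  by move=> h; apply: (le_trans h); rewrite le_eqVlt; apply/orP; left; apply/eqP; ring.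
by rewrite big_split/= -mulr_sumr q1.
Qed.

End sub_gaussian.

(** * Bilinear forms *)

Section bilinear_forms.
Context {R : realType} {I J : finType}.
Implicit Types (x : I -> R) (y : J -> R) (A : I -> J -> R).

Definition bform x A y : R := \sum_i \sum_j x i * A i j * y j.

Lemma bform_addl x x' A y :
  bform (fun i => x i + x' i) A y = bform x A y + bform x' A y.
Proof.
rewrite -big_split; apply: eq_bigr => i _; rewrite -big_split; apply: eq_bigr => j _.
by rewrite !mulrDl.
Qed.

Lemma bform_addr x A y y' :
  bform x A (fun j => y j + y' j) = bform x A y + bform x A y'.
Proof.
rewrite -big_split; apply: eq_bigr => i _; rewrite -big_split; apply: eq_bigr => j _.
by rewrite !mulrDr.
Qed.

Lemma bform_addm x A A' y :
  bform x (fun i j => A i j + A' i j) y = bform x A y + bform x A' y.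
Proof.
rewrite -big_split; apply: eq_bigr => i _; rewrite -big_split; apply: eq_bigr => j _.
by rewrite mulrDr mulrDl.
Qed.

Lemma bformE x A y : bform x A y = \sum_i x i * \sum_j A i j * y j.
Proof.
by apply: eq_bigr => i _; rewrite mulr_sumr; apply: eq_bigr => j _; rewrite mulrA.
Qed.

(** Schur's test, in the form x_i A_ij y_j <= |A_ij| (x_i^2 + y_j^2) / 2. *)
Lemma bform_schur x A y r : \sum_i x i ^+ 2 <= 1 -> \sum_j y j ^+ 2 <= 1 ->
  (forall i, \sum_j `|A i j| <= r) -> (forall j, \sum_i `|A i j| <= r) ->
  0 <= r -> bform x A y <= r.
Proof.
move=> x1 y1 Ar Ac r0.
apply: (@le_trans _ _ (2^-1 * (\sum_i x i ^+ 2 * \sum_j `|A i j|) +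
                       2^-1 * (\sum_j y j ^+ 2 * \sum_i `|A i j|))).
  under [X in _ + 2^-1 * X]eq_bigr do rewrite mulr_sumr.
  rewrite [X in _ + 2^-1 * X]exchange_big/= !mulr_sumr -big_split/=.
  apply: ler_sum => i _; rewrite !mulr_sumr -big_split/=; apply: ler_sum => j _.
  rewrite (le_trans (ler_norm _))// !normrM.
  rewrite -[x i ^+ 2]real_normK ?num_real// -[y j ^+ 2]real_normK ?num_real//.
  have := mulr_ge0 (normr_ge0 (A i j)) (sqr_ge0 (`|x i| - `|y j|)).
  lra.
have h1 : \sum_i x i ^+ 2 * \sum_j `|A i j| <= r.
  apply: (@le_trans _ _ (\sum_i x i ^+ 2 * r)).
    by apply: ler_sum => i _; rewrite ler_wpM2l// sqr_ge0.
  by rewrite -mulr_suml ler_piMl.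
have h2 : \sum_j y j ^+ 2 * \sum_i `|A i j| <= r.
  apply: (@le_trans _ _ (\sum_j y j ^+ 2 * r)).
    by apply: ler_sum => j _; rewrite ler_wpM2l// sqr_ge0.
  by rewrite -mulr_suml ler_piMl.
lra.
Qed.

End bilinear_forms.

Lemma sum_pairE (R : realType) (I J : finType) (F : I * J -> R) :
  \sum_ij F ij = \sum_i \sum_j F (i, j).
Proof. by rewrite pair_bigA; apply: eq_bigr => -[]. Qed.

Lemma sum_rowE (R : realType) (I J : finType) (F : I * J -> R) i :
  \sum_(k | k.1 == i) F k = \sum_j F (i, j).
Proof.
rewrite big_mkcond sum_pairE (bigD1 i)//= [X in _ + X]big1 ?addr0 => [|i' /negPf ii'].
  by apply: eq_bigr => j _; rewrite eqxx.
by rewrite big1// => j _; rewrite ii'.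
Qed.

Lemma sum_colE (R : realType) (I J : finType) (F : I * J -> R) j :
  \sum_(k | k.2 == j) F k = \sum_i F (i, j).
Proof.
rewrite big_mkcond sum_pairE; apply: eq_bigr => i _; rewrite (bigD1 j)//= eqxx.
by rewrite big1 ?addr0// => j' /negPf ->.
Qed.

Lemma bform_tr (R : realType) (I J : finType) (x : I -> R) (A : I -> J -> R) y :
  bform x A y = bform y (fun j i => A i j) x.
Proof.
rewrite /bform exchange_big; apply: eq_bigr => j _; apply: eq_bigr => i _.
by ring.
Qed.

(** Termwise inequality of the arithmetic and geometric means, with weights adapted
    to the bound s. *)
Lemma cauchy_schwarz_le (R : realType) (J : finType) (u y : J -> R) s : 0 < s ->
  \sum_j u j ^+ 2 <= s ^+ 2 -> \sum_j y j ^+ 2 <= 1 -> \sum_j u j * y j <= s.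
Proof.
move=> s0 us y1.
apply: (@le_trans _ _ (\sum_j ((2 * s)^-1 * u j ^+ 2 + s / 2 * y j ^+ 2))).
  apply: ler_sum => j _.
  have -> : (2 * s)^-1 * u j ^+ 2 + s / 2 * y j ^+ 2 =
      u j * y j + (2 * s)^-1 * (u j - s * y j) ^+ 2 by field; rewrite gt_eqF.
  by rewrite lerDl mulr_ge0 ?sqr_ge0// invr_ge0 mulr_ge0 ?ltW.
rewrite big_split/= -!mulr_sumr.
apply: (@le_trans _ _ ((2 * s)^-1 * s ^+ 2 + s / 2 * 1)).
  have s1 : 0 <= (2 * s)^-1 by rewrite invr_ge0 mulr_ge0 ?ltW.
  by apply: lerD; apply: ler_wpM2l => //; rewrite divr_ge0 ?ltW.
by rewrite le_eqVlt; apply/orP; left; apply/eqP; field; rewrite gt_eqF.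
Qed.

Section random_bilinear_forms.
Context {R : realType} {V : finType} (q : V -> R).
Hypothesis q0 : forall v, 0 <= q v.
Hypothesis q1 : \sum_v q v = 1.

(** Only x runs through a grid, and y is eliminated by the Cauchy-Schwarz
    inequality: it remains to bound |a^T x|^2, a sum of independent squares.  The
    grid has mesh 1 / (2 sqrt m), and the integer vectors z with |z|^2 <= 4 m
    automatically have at most 4 m nonzero coordinates, whence about N^(4 m) points
    for th = ln N. *)
Lemma sparse_bform_le (I J : finType) (a : V -> R) (D v lam M m th s : R) :
  \sum_t q t * a t = 0 -> 0 < D -> (forall t, `|a t| <= D) ->
  \sum_t q t * a t ^+ 2 <= v ->
  0 <= lam -> 0 <= M -> 12 * (2 * M + 1) * lam * D ^+ 2 <= 1 ->
  1 <= m -> 2 <= expR th -> 0 < s ->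
  exists E : pred {ffun I * J -> V},
    Pr q E <= expR (th * (4 * m) + 4 * expR (- th) * #|I|%:R) *
      expR ((2 * lam * v + 3 * expR (3 - M)) * #|J|%:R - lam * s ^+ 2) /\
    forall w, ~~ E w -> forall (x : I -> R) (y : J -> R),
      \sum_i x i ^+ 2 <= 1 -> \sum_j y j ^+ 2 <= 1 ->
      #|[pred i | x i != 0]|%:R <= m ->
      bform x (fun i j => a (w (i, j))) y <= 2 * s.
Proof.
move=> qa D0 aD av lam0 M0 lamD m1 th2 s0.
have m0 : 0 < m by lra.
have sm0 : 0 < Num.sqrt m by rewrite sqrtr_gt0.
have sm2 : Num.sqrt m ^+ 2 = m by rewrite sqr_sqrtr// ltW.
pose h := (2 * Num.sqrt m)^-1.
have h0 : 0 < h by rewrite invr_gt0 mulr_gt0.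
have hm : h ^- 2 = 4 * m by rewrite /h -exprVn invrK exprMn sm2; ring.
pose Z := (Num.truncn (2 * Num.sqrt m)).+1.
have hZ : 1 <= h * Z%:R.
  by rewrite mulrC ler_pdivlMr ?mulr_gt0// mul1r; exact/ltW/truncnS_gt.
pose c (z : {ffun I -> 'I_(Z + Z.+1)}) i : R := h * centered (z i).
have c1 z : z \in lattice I Z (h ^- 2) -> \sum_i c z i ^+ 2 <= 1.
  rewrite inE => zl; under eq_bigr do rewrite exprMn.
  rewrite -mulr_sumr -(divff (_ : h ^+ 2 != 0)) ?expf_neq0 ?gt_eqF//.
  by rewrite ler_wpM2l ?sqr_ge0.
pose W z (w : {ffun I * J -> V}) j := \sum_i c z i * a (w (i, j)).
exists (fun w => [exists (z | z \in lattice I Z (h ^- 2)),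
                    s ^+ 2 <= \sum_j W z w j ^+ 2]); split.
  rewrite (le_trans (Pr_union_le q0 q1 _ _))//.
  apply: (@le_trans _ _ (\sum_(z in lattice I Z (h ^- 2))
    expR ((2 * lam * v + 3 * expR (3 - M)) * #|J|%:R - lam * s ^+ 2))).
    apply: ler_sum => z zl; rewrite expRD.
    apply: (Pr_expR q0 (F := fun w => lam * \sum_j W z w j ^+ 2)).
      by move=> w h1; exact: ler_wpM2l.
    pose G (j : J) (u : {ffun I -> V}) := expR (lam * (\sum_i c z i * a (u i)) ^+ 2).
    rewrite (@eq_Ex _ _ _ _ _ (fun w : {ffun I * J -> V} =>
       \prod_j G j [ffun i => w (i, j)])); last first.
      move=> w; rewrite -expR_sum mulr_sumr; congr expR; apply: eq_bigr => j _.
      by congr (_ * _ ^+ 2); apply: eq_bigr => i _; rewrite ffunE.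
    rewrite Ex_columns expRM_natr -prodr_const; apply: ler_prod => j _.
    rewrite Ex_ge0//= => [|u]; last exact: expR_ge0.
    rewrite (le_trans (Ex_expR_sqr_var q0 q1 qa D0 aD av (c1 z zl) lam0 M0 lamD))//.
    by rewrite -addrA expR_ge1Dx.
  rewrite sumr_const -[leLHS]mulr_natl ler_wpM2r ?expR_ge0//.
  by rewrite -hm card_lattice.
move=> w /existsPn wE x y x1 y1 xm.
pose tau i : R := (x i != 0)%:R.
rewrite bformE.
apply: (linear_form_net (tau := tau) h0 hZ) => //.
- rewrite (_ : 4 * h ^+ 2 = m^-1); last first.
    by rewrite -[h ^+ 2]invrK hm invfM mulrA divff ?mul1r.
  rewrite ler_pdivrMl// mulr1 (le_trans _ xm)// ler_nat; apply: subset_leq_card.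
  by apply/fintype.subsetP => i; rewrite !inE /tau; case: (x i != 0); rewrite ?eqxx.
- move=> i; rewrite /tau; case: (x i != 0); rewrite ?eqxx// => _.
  rewrite /h invfM mulrA divff// mul1r invf_le1// -(@ler_pXn2r _ 2) ?nnegrE ?(ltW sm0)//.
  by rewrite expr1n sm2.
- move=> z zl _.
  have -> : \sum_i h * centered (z i) * (\sum_j a (w (i, j)) * y j) =
            \sum_j W z w j * y j.
    rewrite -(bformE (c z) (fun i j => a (w (i, j)))) bform_tr bformE.
    apply: eq_bigr => j _; rewrite mulrC; congr (_ * _); apply: eq_bigr => i _.
    by rewrite mulrC.
  apply: cauchy_schwarz_le => //.
  by have := wE z; rewrite zl /= -ltNge => /ltW.
move=> i; rewrite /tau; have [->|xi] := eqVneq (x i) 0; first by rewrite normr0.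
rewrite -(@ler_pXn2r _ 2) ?nnegrE// expr1n real_normK ?num_real//.
by rewrite (le_trans _ x1)// (bigD1 i)//= lerDl sumr_ge0// => j _; exact: sqr_ge0.
Qed.

(** No entry of the array weighs more than tau^2 D in the form, so that the variance
    governs its exponential moments up to lam = 1 / (2 tau^2 D).  Both vectors run
    through grids of mesh 1 / (2 sqrt N), with at most exp (6 N) points each. *)
Lemma light_bform_le (I J : finType) (a : V -> R) (D v lam tau : R) N (T : R) :
  \sum_t q t * a t = 0 -> (forall t, `|a t| <= D) ->
  \sum_t q t * a t ^+ 2 <= v -> 0 <= v ->
  (#|I| <= N)%N -> (#|J| <= N)%N -> (0 < N)%N ->
  0 <= lam -> 1 <= tau * Num.sqrt N%:R -> 0 <= tau ->
  lam * (tau ^+ 2 * D) <= 2^-1 ->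
  exists E : pred {ffun I * J -> V},
    Pr q E <= expR (12 * N%:R + 2 * lam ^+ 2 * v - lam * T) /\
    forall w, ~~ E w -> forall (x : I -> R) (y : J -> R),
      \sum_i x i ^+ 2 <= 1 -> \sum_j y j ^+ 2 <= 1 ->
      (forall i, `|x i| <= tau) -> (forall j, `|y j| <= tau) ->
      bform x (fun i j => a (w (i, j))) y <= 4 * T.
Proof.
move=> qa aD av v0 IN JN N0 lam0 tauN tau0 lamD.
have N0' : 0 < N%:R :> R by rewrite ltr0n.
have sN0 : 0 < Num.sqrt N%:R :> R by rewrite sqrtr_gt0.
have sN2 : Num.sqrt N%:R ^+ 2 = N%:R :> R by rewrite sqr_sqrtr// ltW.
pose h : R := (2 * Num.sqrt N%:R)^-1.
have h0 : 0 < h by rewrite invr_gt0 mulr_gt0.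
have hN : h ^- 2 = 4 * N%:R by rewrite /h -exprVn invrK exprMn sN2; ring.
pose Z := (Num.truncn (2 * Num.sqrt N%:R : R)).+1.
have hZ : 1 <= h * Z%:R.
  by rewrite mulrC ler_pdivlMr ?mulr_gt0// mul1r; exact/ltW/truncnS_gt.
have tau2h : 2 * h <= tau.
  by rewrite /h invfM mulrA divff// mul1r -[_^-1]mul1r ler_pdivrMr.
have htau (K : finType) : (#|K| <= N)%N ->
    4 * h ^+ 2 * #|[pred i : K | tau != 0]|%:R <= 1.
  move=> KN; rewrite (_ : 4 * h ^+ 2 = N%:R^-1); last first.
    by rewrite -[h ^+ 2]invrK hN invfM mulrA divff ?mul1r.
  by rewrite ler_pdivrMl// mulr1 ler_nat (leq_trans (max_card _)).
have card (K : finType) : (#|K| <= N)%N ->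
    (#|lattice K Z (h ^- 2)|%:R : R) <= expR (6 * N%:R).
  move=> KN; have e2 : 2 <= expR 1 :> R by exact: le_trans (expR_ge1Dx 1).
  rewrite (le_trans (card_lattice _ _ _ e2))// ler_expR hN.
  have : expR (- 1) <= 2^-1 :> R by rewrite expRN lef_pV2// posrE ?expR_gt0.
  have : (#|K|%:R : R) <= N%:R by rewrite ler_nat.
  have : 0 <= (#|K|%:R : R) by [].
  by have := expR_ge0 (- 1 : R); nra.
pose c (K : finType) (z : {ffun K -> 'I_(Z + Z.+1)}) i : R := h * centered (z i).
have c1 (K : finType) z : z \in lattice K Z (h ^- 2) -> \sum_i c K z i ^+ 2 <= 1.
  rewrite inE => zl; under eq_bigr do rewrite exprMn.
  rewrite -mulr_sumr -(divff (_ : h ^+ 2 != 0)) ?expf_neq0 ?gt_eqF//.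
  by rewrite ler_wpM2l ?sqr_ge0.
pose ok (K : finType) (z : {ffun K -> 'I_(Z + Z.+1)}) :=
  [forall i, `|c K z i| <= tau].
pose P (z : {ffun I -> 'I_(Z + Z.+1)} * {ffun J -> 'I_(Z + Z.+1)}) :=
  (z \in finset.setX (lattice I Z (h ^- 2)) (lattice J Z (h ^- 2))) && (ok I z.1 && ok J z.2).
pose C (z : {ffun I -> 'I_(Z + Z.+1)} * {ffun J -> 'I_(Z + Z.+1)}) (ij : I * J) :=
  c I z.1 ij.1 * c J z.2 ij.2.
exists (fun w => [exists (z | P z), T <= \sum_ij C z ij * a (w ij)]); split.
  rewrite (le_trans (Pr_union_le q0 q1 _ _))//.
  apply: (@le_trans _ _ (\sum_(z | P z) expR (2 * lam ^+ 2 * v - lam * T))).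
    apply: ler_sum => z /andP[]; rewrite inE => /andP[z1 z2] /andP[/forallP o1 /forallP o2].
    rewrite expRD.
    apply: (Pr_expR q0 (F := fun w : {ffun I * J -> V} => lam * \sum_ij C z ij * a (w ij))).
      by move=> w h1; exact: ler_wpM2l.
    apply: le_trans (Ex_expR_bilinear (v := v) q0 q1 qa av _) _.
      move=> [i j] t; rewrite (le_trans _ lamD)// ler_wpM2l//.
      rewrite (le_trans (ler_norm _))// normrM ler_pM// /C/= normrM expr2.
      by rewrite ler_pM.
    rewrite ler_expR -[leRHS]mulr1 ler_wpM2l//.
      by rewrite mulr_ge0// mulr_ge0// sqr_ge0.
    rewrite sum_pairE.
    have -> : \sum_i \sum_j C z (i, j) ^+ 2 =
        (\sum_i c I z.1 i ^+ 2) * (\sum_j c J z.2 j ^+ 2).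
      rewrite mulr_suml; apply: eq_bigr => i _; rewrite mulr_sumr.
      by apply: eq_bigr => j _; rewrite /C exprMn.
    rewrite -[leRHS]mulr1 ler_pM ?c1// sumr_ge0// => i _; exact: sqr_ge0.
  rewrite -addrA [leRHS]expRD sumr_const -[leLHS]mulr_natl ler_wpM2r ?expR_ge0//.
  apply: (@le_trans _ _ (#|finset.setX (lattice I Z (h ^- 2)) (lattice J Z (h ^- 2))|%:R)).
    by rewrite ler_nat; apply: subset_leq_card; apply/fintype.subsetP => z /andP[].
  rewrite cardsX natrM (_ : 12 * N%:R = 6 * N%:R + 6 * N%:R :> R); last by ring.
  by rewrite expRD ler_pM// card.
move=> w /existsPn wE x y x1 y1 xtau ytau.
have -> : 4 * T = 2 * (2 * T) by ring.
have normc (K : finType) (z : {ffun K -> _}) :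
    (forall i, h * `|centered (z i)| <= tau) -> ok K z.
  by move=> hz; apply/forallP => i; rewrite normrM (gtr0_norm h0).
rewrite bformE.
apply: (linear_form_net (tau := fun=> tau) h0 hZ (htau I IN)) => // z zl /normc zok.
rewrite -(bformE (c I z) (fun i j => a (w (i, j)))) bform_tr bformE.
apply: (linear_form_net (tau := fun=> tau) h0 hZ (htau J JN)) => // z' zl' /normc zok'.
have := wE (z, z'); rewrite /P inE/= zl zl' zok zok'/= -ltNge => /ltW.
apply: le_trans; rewrite -(bformE (c J z') (fun j i => a (w (i, j)))) bform_tr.
rewrite sum_pairE.
rewrite le_eqVlt; apply/orP; left; apply/eqP.
by apply: eq_bigr => i _; apply: eq_bigr => j _; rewrite /C/=; ring.
Qed.

End random_bilinear_forms.

(** * The norm of a finitely valued sparse array *)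

Section sparse_discrete_matrix.
Context {R : realType} {V : finType} (q : V -> R).
Hypothesis q0 : forall v, 0 <= q v.
Hypothesis q1 : \sum_v q v = 1.

Lemma Pr_reindex (I J : finType) (g : J -> I) (g' : I -> J)
    (E : pred {ffun J -> V}) : cancel g g' -> cancel g' g ->
  Pr q E = Pr q (fun w : {ffun I -> V} => E [ffun j => w (g j)]).
Proof. by move=> gK g'K; rewrite /Pr (Ex_reindex q _ gK g'K). Qed.

(** The map g is one of the two projections of I * J, so that its fibres are the
    lines of the array.  With th = 1 / (2 H) in Chernoff's bound, a line sum exceeds
    2 r + 4 H ln N with probability at most N^(- 2), and there are at most N lines. *)
Lemma line_sums_le (K I : finType) (g : K -> I) (b : V -> R) (N : nat) (H r : R) :
  (0 < N)%N -> (#|I| <= N)%N -> (forall i, (#|[pred k | g k == i]| <= N)%N) ->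
  (forall v, 0 <= b v) -> (forall v, b v <= H) -> 0 < H -> 0 <= r ->
  N%:R * \sum_v q v * b v <= r -> ln N%:R * H <= r ->
  exists E : pred {ffun K -> V},
    Pr q E <= expR (- ln N%:R) /\
    forall w, ~~ E w -> forall i, \sum_(k | g k == i) b (w k) <= 6 * r.
Proof.
move=> N0 IN gN b0 bH H0 r0 mean Hr.
have N0' : 0 < N%:R :> R by rewrite ltr0n.
pose th := (2 * H)^-1.
have th0 : 0 <= th by rewrite invr_ge0 mulr_ge0 ?ltW.
have thH : th * H = 2^-1 by rewrite /th; field; rewrite gt_eqF.
exists (fun w => [exists (i | true), 6 * r <= \sum_(k | g k == i) b (w k)]); split; last first.
  by move=> w /existsPn wE i; have := wE i; rewrite /= -ltNge => /ltW.
rewrite (le_trans (Pr_union_le q0 q1 _ _))//.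
apply: (@le_trans _ _ (\sum_(i : I) expR (- (2 * ln N%:R)))); last first.
  rewrite sumr_const -[leLHS]mulr_natl mulrDl !mul1r opprD expRD mulrA.
  rewrite ler_piMl ?expR_ge0// expRN lnK ?posrE// ler_pdivrMr// mul1r.
  by rewrite ler_nat.
apply: ler_sum => i _.
apply: le_trans (Pr_sum_ge q0 q1 [pred k | g k == i] _ th0 _) _.
  by move=> v; rewrite mulr_ge0// -thH ler_wpM2l.
rewrite ler_expR; set S := \sum_v _ in mean *; set c := #|_|.
have S0 : 0 <= S by apply: sumr_ge0 => v _; rewrite mulr_ge0.
have cS : S * c%:R <= r.
  by rewrite mulrC (le_trans _ mean)// ler_wpM2r// ler_nat; exact: gN.
have h1 := ler_wpM2l th0 cS; have h2 := ler_wpM2l th0 Hr.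
have -> : 2 * ln N%:R = 4 * (th * (ln N%:R * H)).
  by rewrite (mulrC _ H) [th * _]mulrA thH; field.
lra.
Qed.

(** The array splits into a centred part bounded by 2 L, the mean that was
    subtracted, and the entries beyond L; the last two are left to Schur's test.
    Each vector splits into its coordinates beyond m^(- 1/2), at most m of them in
    the unit ball, and the other ones.  If x or y is sparse the form is at most
    4 s, and if both have small coordinates it is at most 60 s. *)
Lemma discrete_bform_le (I J : finType) (a : V -> R) (N : nat)
    (p L H m lam M s : R) :
  (2 <= N)%N -> (#|I| <= N)%N -> (#|J| <= N)%N ->
  0 < p -> 0 < s -> s ^+ 2 = N%:R * p ->
  \sum_v q v * a v ^+ 2 <= p ->
  0 < H -> (forall v, `|a v| <= H) -> ln N%:R * H <= s ->
  N%:R * \sum_v q v * (if `|a v| <= L then 0 else `|a v|) <= s ->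
  N%:R * `|\sum_v q v * (if `|a v| <= L then a v else 0)| <= s ->
  0 < L -> 0 <= lam -> 0 <= M -> 12 * (2 * M + 1) * lam * (2 * L) ^+ 2 <= 1 ->
  3 * expR (3 - M) <= lam * p ->
  1 <= m -> m <= N%:R -> 6 * m * ln N%:R <= lam * p * N%:R ->
  4 * L * N%:R <= m * s ->
  exists E : pred {ffun I * J -> V},
    Pr q E <= 5 * expR (4 - ln N%:R) /\
    forall w, ~~ E w -> forall (x : I -> R) (y : J -> R),
      \sum_i x i ^+ 2 <= 1 -> \sum_j y j ^+ 2 <= 1 ->
      bform x (fun i j => a (w (i, j))) y <= 75 * s.
Proof.
move=> N2 IN JN p0 s0 s2 a2 H0 aH lnH tail mean L0 lam0 M0 lamL eM m1 mN mlam light.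
have N0 : (0 < N)%N by exact: ltn_trans N2.
have N0' : 0 < N%:R :> R by rewrite ltr0n.
have lnN0 : 0 <= ln N%:R :> R by rewrite ln_ge0// (ler_nat _ 1).
have m0 : 0 < m by lra.
pose lt v : R := if `|a v| <= L then a v else 0.
pose b v : R := if `|a v| <= L then 0 else `|a v|.
pose c := \sum_v q v * lt v.
pose a0 v := lt v - c.
have ltL v : `|lt v| <= L by rewrite /lt; case: ifP => // _; rewrite normr0 ltW.
have cL : `|c| <= L.
  rewrite (le_trans (ler_norm_sum _ _ _))//.
  apply: (@le_trans _ _ (\sum_v q v * L)); last by rewrite -mulr_suml q1 mul1r.
  by apply: ler_sum => v _; rewrite normrM (ger0_norm (q0 v)) ler_wpM2l.
have a0L v : `|a0 v| <= 2 * L.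
  by rewrite (le_trans (ler_normB _ _))// mulr2n mulrDl !mul1r lerD.
have qa0 : \sum_v q v * a0 v = 0.
  under eq_bigr do rewrite mulrBr.
  by rewrite big_split/= sumrN -mulr_suml q1 mul1r subrr.
have qa02 : \sum_v q v * a0 v ^+ 2 <= p.
  have -> : \sum_v q v * a0 v ^+ 2 = \sum_v q v * lt v ^+ 2 - c ^+ 2.
    rewrite (eq_bigr (fun v => q v * lt v ^+ 2 + (- (2 * c) * (q v * lt v) +
       q v * c ^+ 2))); last by move=> v _; rewrite /a0; ring.
    by rewrite !big_split/= -mulr_sumr -mulr_suml q1 -/c; ring.
  rewrite lerBlDr (le_trans (le_trans _ a2))//; last by rewrite lerDl sqr_ge0.
  apply: ler_sum => v _; rewrite ler_wpM2l// /lt; case: ifP => // _.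
  by rewrite expr0n/= sqr_ge0.
have e2 : 2 <= expR (ln N%:R) :> R by rewrite lnK ?posrE// (ler_nat _ 2).
have s20 : 0 < 2 * s by rewrite mulr_gt0.
have L20 : 0 < 2 * L by rewrite mulr_gt0.
have sparse_pr (K K' : finType) : (#|K| <= N)%N -> (#|K'| <= N)%N ->
    expR (ln N%:R * (4 * m) + 4 * expR (- ln N%:R) * #|K|%:R) *
    expR ((2 * lam * p + 3 * expR (3 - M)) * #|K'|%:R - lam * (2 * s) ^+ 2) <=
    expR (4 - ln N%:R).
  move=> KN K'N; rewrite -expRD ler_expR expRN lnK ?posrE//.
  have h1 : 4 / N%:R * #|K|%:R <= 4 :> R.
    by rewrite mulrAC ler_pdivrMr// ler_wpM2l// ler_nat.
  have K0 : (0 : R) <= #|K'|%:R by [].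
  have h2 : (2 * lam * p + 3 * expR (3 - M)) * #|K'|%:R <= 3 * (lam * p * N%:R).
    apply: (@le_trans _ _ (3 * lam * p * #|K'|%:R)); first by rewrite ler_wpM2r//; lra.
    rewrite -!mulrA !ler_wpM2l// ?(ltW p0)//.
    by rewrite ler_nat.
  have -> : lam * (2 * s) ^+ 2 = 4 * (lam * p * N%:R) by rewrite exprMn s2; ring.
  have h3 : ln N%:R <= m * ln N%:R by rewrite ler_peMl.
  lra.
have [E1 [PE1 hE1]] := sparse_bform_le q0 q1 I J qa0 L20 a0L qa02 lam0 M0 lamL m1 e2 s20.
have [E2 [PE2 hE2]] := sparse_bform_le q0 q1 J I qa0 L20 a0L qa02 lam0 M0 lamL m1 e2 s20.
have {}PE1 := le_trans PE1 (sparse_pr _ _ IN JN).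
have {}PE2 := le_trans PE2 (sparse_pr _ _ JN IN).
pose sw (K K' : finType) (kk : K * K') := (kk.2, kk.1).
have swK (K K' : finType) : cancel (@sw K K') (@sw K' K) by case.
pose E2' (w : {ffun I * J -> V}) := E2 [ffun ji => w (sw J I ji)].
have {}PE2 : Pr q E2' <= expR (4 - ln N%:R).
  by rewrite -(Pr_reindex E2 (swK J I) (swK I J)).
pose tau := (Num.sqrt m)^-1.
have sm0 : 0 < Num.sqrt m by rewrite sqrtr_gt0.
have tau0 : 0 < tau by rewrite invr_gt0.
have tau2 : tau ^+ 2 = m^-1 by rewrite /tau exprVn sqr_sqrtr// ltW.
have tauN : 1 <= tau * Num.sqrt N%:R.
  by rewrite mulrC ler_pdivlMr// mul1r ler_wsqrtr.
have k0 : 0 <= N%:R / s by rewrite divr_ge0 ?ltW.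
have kL : N%:R / s * (tau ^+ 2 * (2 * L)) <= 2^-1.
  have -> : N%:R / s * (tau ^+ 2 * (2 * L)) = (2 * L * N%:R) / (m * s).
    by rewrite tau2; field; rewrite !gt_eqF.
  by rewrite ler_pdivrMr ?mulr_gt0//; lra.
(* With lam = N / s one has lam^2 p = N, so that 15 s costs exp (- 15 N), against
   exp (12 N) pairs of grid points and exp (2 N) for the exponential moment. *)
have [E3 [PE3 hE3]] := light_bform_le q0 q1 (15 * s) qa0 a0L qa02 (ltW p0) IN JN N0 k0
  tauN (ltW tau0) kL.
have {}PE3 : Pr q E3 <= expR (4 - ln N%:R).
  rewrite (le_trans PE3)// ler_expR.
  have -> : 12 * N%:R + 2 * (N%:R / s) ^+ 2 * p - N%:R / s * (15 * s) = - N%:R :> R.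
    have -> : 2 * (N%:R / s) ^+ 2 * p = 2 * N%:R * (N%:R * p) / s ^+ 2.
      by field; rewrite gt_eqF.
    rewrite s2; field; rewrite !gt_eqF//.
  have := ln_sublinear N0'; lra.
have b0 v : 0 <= b v by rewrite /b; case: ifP.
have bH v : b v <= H by rewrite /b; case: ifP => // _; exact: ltW.
have rowN (i : I) : (#|[pred k : I * J | k.1 == i]| <= N)%N.
  apply: leq_trans (leq_trans (leq_imset_card (fun j : J => (i, j)) J) JN).
  apply: subset_leq_card; apply/fintype.subsetP => -[i' j]; rewrite inE/= => /eqP ->.
  exact: imset_f.
have colN (j : J) : (#|[pred k : I * J | k.2 == j]| <= N)%N.
  apply: leq_trans (leq_trans (leq_imset_card (fun i : I => (i, j)) I) IN).
  apply: subset_leq_card; apply/fintype.subsetP => -[i j']; rewrite inE/= => /eqP ->.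
  exact: imset_f.
have [E4 [PE4 hE4]] := line_sums_le N0 IN rowN b0 bH H0 (ltW s0) tail lnH.
have [E5 [PE5 hE5]] := line_sums_le N0 JN colN b0 bH H0 (ltW s0) tail lnH.
have e4 : expR (- ln N%:R) <= expR (4 - ln N%:R) :> R by rewrite ler_expR; lra.
exists (fun w => E1 w || (E2' w || (E3 w || (E4 w || E5 w)))); split.
  do 4 (apply: (le_trans (PrU q0 _ _)); rewrite -?lerBrDl).
  lra.
move=> w; rewrite !negb_or => /and5P[w1 w2 w3 w4 w5] x y x1 y1.
pose big (K : finType) (z : K -> R) k := if `|z k| <= tau then 0 else z k.
pose small (K : finType) (z : K -> R) k := if `|z k| <= tau then z k else 0.
have big_small (K : finType) (z : K -> R) : z =1 (fun k => big K z k + small K z k).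
  by move=> k; rewrite /big /small; case: ifP => _; rewrite ?add0r ?addr0.
have big1 (K : finType) (z : K -> R) : \sum_k z k ^+ 2 <= 1 -> \sum_k big K z k ^+ 2 <= 1.
  apply: le_trans; apply: ler_sum => k _; rewrite /big; case: ifP => // _.
  by rewrite expr0n/= sqr_ge0.
have small1 (K : finType) (z : K -> R) : \sum_k z k ^+ 2 <= 1 -> \sum_k small K z k ^+ 2 <= 1.
  apply: le_trans; apply: ler_sum => k _; rewrite /small; case: ifP => // _.
  by rewrite expr0n/= sqr_ge0.
have small_le (K : finType) (z : K -> R) k : `|small K z k| <= tau.
  by rewrite /small; case: ifP => // _; rewrite normr0 ltW.
have big_card (K : finType) (z : K -> R) : \sum_k z k ^+ 2 <= 1 ->
    #|[pred k | big K z k != 0]|%:R <= m.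
  move=> /big1 z1; rewrite -[leRHS]mul1r -ler_pdivrMr// (le_trans _ z1)//.
  rewrite (bigID (fun k => big K z k != 0))/= ler_wpDr ?sumr_ge0//.
    by move=> k _; exact: sqr_ge0.
  rewrite -sum1_card natr_sum mulr_suml; apply: ler_sum => k.
  rewrite inE /big; case: ifP => [_|/negbT]; first by rewrite eqxx.
  rewrite -ltNge => tz _.
  by rewrite mul1r -tau2 -[leRHS]real_normK ?num_real// lerXn2r ?nnegrE ?(ltW tau0) ?(ltW tz).
pose A0 i j := a0 (w (i, j)).
pose A1 i j := c + (a (w (i, j)) - lt (w (i, j))).
have -> : bform x (fun i j => a (w (i, j))) y = bform x A0 y + bform x A1 y.
  rewrite -bform_addm; apply: eq_bigr => i _; apply: eq_bigr => j _.
  by rewrite /A0 /A1 /a0; ring.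
have hA1 : bform x A1 y <= 7 * s.
  have A1b i j : `|A1 i j| <= `|c| + b (w (i, j)).
    rewrite (le_trans (ler_normD _ _))// lerD2l /lt /b.
    by case: ifP => _; rewrite ?subrr ?normr0// subr0.
  have cN k : (k <= N)%N -> `|c| *+ k <= s.
    move=> kN; rewrite -mulr_natl (le_trans _ mean)// ler_wpM2r// ler_nat//.
  apply: bform_schur => //; last by rewrite mulr_ge0 ?ltW.
    move=> i; apply: (@le_trans _ _ (\sum_j (`|c| + b (w (i, j))))).
      by apply: ler_sum => j _.
    rewrite big_split/= sumr_const.
    have := hE4 w w4 i; rewrite sum_rowE.
    have := cN _ JN; lra.
  move=> j; apply: (@le_trans _ _ (\sum_i (`|c| + b (w (i, j))))).
    by apply: ler_sum => i _.
  rewrite big_split/= sumr_const.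
  have := hE5 w w5 j; rewrite sum_colE.
  have := cN _ IN; lra.
have h1 : bform (big I x) A0 y <= 2 * (2 * s).
  by apply: (hE1 w w1); [exact: big1|exact: y1|exact: big_card].
have h2 : bform (small I x) A0 (big J y) <= 2 * (2 * s).
  rewrite bform_tr.
  have := hE2 _ w2 (big J y) (small I x) (big1 _ _ y1) (small1 _ _ x1) (big_card _ _ y1).
  by congr (_ <= _); apply: eq_bigr => j _; apply: eq_bigr => i _; rewrite ffunE.
have h3 : bform (small I x) A0 (small J y) <= 4 * (15 * s).
  by apply: (hE3 w w3) => //; exact: small1.
have -> : bform x A0 y = bform (big I x) A0 y + bform (small I x) A0 y.
  rewrite -bform_addl; apply: eq_bigr => i _; apply: eq_bigr => j _.
  by rewrite -big_small.
have -> : bform (small I x) A0 y =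
    bform (small I x) A0 (big J y) + bform (small I x) A0 (small J y).
  rewrite -bform_addr; apply: eq_bigr => i _; apply: eq_bigr => j _.
  by rewrite -big_small.
lra.
Qed.

End sparse_discrete_matrix.

(** * The largest singular value *)

(** If v is an eigenvector of A^T A for s^2, the form reaches the value s at the
    normalized vectors A v and v. *)
Lemma singular_value_le (R : realType) (m n : nat) (A : 'M[R]_(m, n)) M :
  (0 < n)%N -> 0 <= M ->
  (forall (x : 'I_m -> R) (y : 'I_n -> R), \sum_i x i ^+ 2 <= 1 ->
     \sum_j y j ^+ 2 <= 1 -> bform x A y <= M) ->
  (singular_values A)`_0 <= M.
Proof.
move=> n0 M0 AM; set s := _`_0.
have sin : s \in singular_values A by rewrite mem_nth// size_singular_values.
have [s0|s0] := leP s 0; first exact: le_trans M0.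
have : root (char_poly (A^T *m A)) (s ^+ 2).
  rewrite char_poly_singular_values.
  rewrite (_ : \prod_(_ <- _) _ = \prod_(x <- [seq x ^+ 2 | x <- singular_values A]) ('X - x%:P)).
    by rewrite root_prod_XsubC; exact: map_f.
  by rewrite big_map.
rewrite -eigenvalue_root_char => /eigenvalueP[v vE v0].
pose u := v *m A^T.
pose V := \sum_j v 0 j ^+ 2.
have V0 : 0 < V.
  rewrite lt_def sumr_ge0 ?andbT => [|i _]; last exact: sqr_ge0.
  rewrite psumr_eq0; last by move=> i _; exact: sqr_ge0.
  apply: contra v0 => /allP h; apply/eqP/rowP => i; rewrite mxE.
  by apply/eqP; have := h i (mem_index_enum _); rewrite /= sqrf_eq0.
have uE i : u 0 i = \sum_j A i j * v 0 j.
  by rewrite mxE; apply: eq_bigr => j _; rewrite mxE mulrC.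
have uu : \sum_i u 0 i ^+ 2 = s ^+ 2 * V.
  have -> : \sum_i u 0 i ^+ 2 = (u *m u^T) 0 0.
    by rewrite [RHS]mxE; apply: eq_bigr => i _; rewrite [u^T _ _]mxE expr2.
  rewrite /u trmx_mul trmxK mulmxA -(mulmxA v) vE -scalemxAl mxE; congr (_ * _).
  by rewrite mxE; apply: eq_bigr => i _; rewrite mxE expr2.
have sV0 : 0 < Num.sqrt V by rewrite sqrtr_gt0.
have sV2 : Num.sqrt V ^+ 2 = V by rewrite sqr_sqrtr// ltW.
have := AM (fun i => u 0 i / (s * Num.sqrt V)) (fun j => v 0 j / Num.sqrt V).
under eq_bigr do rewrite exprMn exprVn.
rewrite -mulr_suml uu exprMn sV2 divff ?gt_eqF ?mulr_gt0 ?exprn_gt0//.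
under eq_bigr do rewrite exprMn exprVn.
rewrite -mulr_suml sV2 divff ?gt_eqF// => /(_ (lexx _) (lexx _)).
rewrite (_ : bform _ _ _ = s)//.
rewrite bformE (eq_bigr (fun i => (s * V)^-1 * u 0 i ^+ 2)).
  by rewrite -mulr_sumr uu; field; rewrite !gt_eqF.
move=> i _.
have -> : \sum_j A i j * (v 0 j / Num.sqrt V) = u 0 i / Num.sqrt V.
  by rewrite uE mulr_suml; apply: eq_bigr => j _; rewrite mulrA.
have -> : (s * V)^-1 = (s * Num.sqrt V ^+ 2)^-1 by rewrite sV2.
by field; rewrite !gt_eqF.
Qed.

(** The roots of q are the s^2 - t^2.  If they are all negative, q is a product of
    factors X + a with a > 0; conversely a polynomial with nonnegative coefficients
    and a positive constant one has no root in the nonnegative reals.  The right-hand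
    side involves finitely many coefficients, hence is visibly measurable. *)
Lemma singular_value_ltE (R : realType) (m n : nat) (A : 'M[R]_(m, n)) t :
  (0 < n)%N -> 0 <= t ->
  let q := char_poly (A^T *m A) \Po ('X + (t ^+ 2)%:P) in
  ((singular_values A)`_0 < t) = [forall i : 'I_n.+1, 0 <= q`_i] && (0 < q`_0).
Proof.
move=> n0 t0 q; set s := _`_0.
have sin : s \in singular_values A by rewrite mem_nth// size_singular_values.
have sv_ge0 x : x \in singular_values A -> 0 <= x.
  by rewrite mem_sort => /mapP[y _ ->]; exact: sqrtr_ge0.
have sv_le x : x \in singular_values A -> x <= s.
  move=> /(nthP 0)[i isz <-]; rewrite /s; case: i isz => // i isz.
  have srt : sorted >=%R (singular_values A).
    by apply: sort_sorted => a b; exact: le_total.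
  have ge_trans : transitive (>=%R : rel R) by move=> a b c /= ab ca; exact: le_trans ab.
  apply: (sorted_ltn_nth ge_trans 0 srt) => //; rewrite inE//.
  exact: leq_ltn_trans isz.
have qE : q = \prod_(s <- singular_values A) ('X + (t ^+ 2 - s ^+ 2)%:P).
  rewrite /q char_poly_singular_values rmorph_prod/=; apply: eq_bigr => x _.
  by rewrite comp_polyB comp_polyX comp_polyC polyCB addrA.
apply/idP/andP => [st|[/forallP q0 q00]].
  have : {in singular_values A, forall x, 0 < t ^+ 2 - x ^+ 2}.
    move=> x xs; rewrite subr_gt0 ltrXn2r ?nnegrE ?sv_ge0//.
    exact: le_lt_trans (sv_le _ xs) st.
  have nneg (r : seq R) : {in r, forall x, 0 < t ^+ 2 - x ^+ 2} ->
      (forall i, 0 <= (\prod_(s <- r) ('X + (t ^+ 2 - s ^+ 2)%:P))`_i) /\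
      0 < (\prod_(s <- r) ('X + (t ^+ 2 - s ^+ 2)%:P))`_0.
    elim: r => [|x r IH] rt.
      by rewrite big_nil; split => [i|]; rewrite coefC//; case: ifP.
    have /IH[h1 h2] : {in r, forall x, 0 < t ^+ 2 - x ^+ 2}.
      by move=> y yr; apply: rt; rewrite inE yr orbT.
    have xt : 0 < t ^+ 2 - x ^+ 2 by apply: rt; rewrite inE eqxx.
    rewrite big_cons mulrDl; split => [i|]; rewrite coefD coefXM coefCM.
      by apply: addr_ge0; [case: ifP|rewrite mulr_ge0// ltW].
    by rewrite eqxx add0r mulr_gt0.
  by move=> /nneg[h1 h2]; rewrite qE; split => //; apply/forallP => i.
rewrite ltNge; apply/negP => ts.
have r0 : 0 <= s ^+ 2 - t ^+ 2 by rewrite subr_ge0 lerXn2r ?nnegrE// sv_ge0.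
have : q.[s ^+ 2 - t ^+ 2] = 0.
  rewrite qE horner_prod; apply/eqP; rewrite prodf_seq_eq0; apply/hasP; exists s => //=.
  by rewrite hornerD hornerX hornerC; apply/eqP; ring.
rewrite horner_coef => q_root.
have sq : size q = n.+1.
  by rewrite /q size_comp_poly2 ?size_char_poly ?size_XaddC.
rewrite sq big_ord_recl/= expr0 mulr1 in q_root.
have : 0 < q`_0 + \sum_(i < n) q`_(bump 0 i) * (s ^+ 2 - t ^+ 2) ^+ bump 0 i.
  apply: ltr_wpDr => //; apply: sumr_ge0 => i _; apply: mulr_ge0; last exact: exprn_ge0.
  exact: (q0 (lift ord0 i)).
by rewrite q_root ltxx.
Qed.

Local Open Scope classical_set_scope.
Local Open Scope ring_scope.

Section measurable_singular_value.
Context {d : measure_display} {T : measurableType d} {R : realType}.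

Definition coef_measurable (f : T -> {poly R}) :=
  forall i, measurable_fun setT (fun w => (f w)`_i).

Lemma coef_measurable_cst p : coef_measurable (fun=> p).
Proof. by move=> i; exact: measurable_cst. Qed.

Lemma coef_measurableC (f : T -> R) : measurable_fun setT f ->
  coef_measurable (fun w => (f w)%:P).
Proof.
move=> mf i; under eq_fun do rewrite coefC.
by case: (i == 0%N) => //; exact: measurable_cst.
Qed.

Lemma coef_measurableD f g : coef_measurable f -> coef_measurable g ->
  coef_measurable (fun w => f w + g w).
Proof.
move=> mf mg i; under eq_fun do rewrite coefD.
exact: measurable_funD.
Qed.

Lemma coef_measurableM f g : coef_measurable f -> coef_measurable g ->
  coef_measurable (fun w => f w * g w).
Proof.
move=> mf mg i; under eq_fun do rewrite coefM.
by apply: measurable_sum => k; apply: measurable_funM.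
Qed.

Lemma coef_measurable_sum (I : Type) (r : seq I) F :
  (forall i, coef_measurable (F i)) -> coef_measurable (fun w => \sum_(i <- r) F i w).
Proof.
move=> mF; elim: r => [|i r IH].
  by under eq_fun do rewrite big_nil; exact: coef_measurable_cst.
by under eq_fun do rewrite big_cons; exact: coef_measurableD.
Qed.

Lemma coef_measurable_prod (I : Type) (r : seq I) F :
  (forall i, coef_measurable (F i)) -> coef_measurable (fun w => \prod_(i <- r) F i w).
Proof.
move=> mF; elim: r => [|i r IH].
  by under eq_fun do rewrite big_nil; exact: coef_measurable_cst.
by under eq_fun do rewrite big_cons; exact: coef_measurableM.
Qed.

Lemma coef_measurable_char_poly n (G : T -> 'M[R]_n) :
  (forall i j, measurable_fun setT (fun w => G w i j)) ->
  coef_measurable (fun w => char_poly (G w)).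
Proof.
move=> mG; apply: coef_measurable_sum => s; apply: coef_measurableM.
  exact: coef_measurable_cst.
apply: coef_measurable_prod => i; under eq_fun do rewrite !mxE.
apply: coef_measurableD; first exact: coef_measurable_cst.
under eq_fun do rewrite -polyCN; apply: coef_measurableC.
exact: measurable_funN.
Qed.

(** The criterion of [singular_value_ltE] involves finitely many coefficients of the
    characteristic polynomial, which are polynomials in the entries. *)
Lemma measurable_singular_value (m n : nat) (A : T -> 'M[R]_(m, n)) (t : R) :
  (0 < n)%N -> 0 <= t -> (forall i j, measurable_fun setT (fun w => A w i j)) ->
  measurable [set w | t <= (singular_values (A w))`_0].
Proof.
move=> n0 t0 mA.
pose q w := char_poly ((A w)^T *m A w) \Po ('X + (t ^+ 2)%:P).
have mq : coef_measurable q.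
  rewrite /q; under eq_fun do rewrite comp_polyE size_char_poly.
  apply: coef_measurable_sum => k; under eq_fun do rewrite -mul_polyC.
  apply: coef_measurableM; last exact: coef_measurable_cst.
  apply: coef_measurableC; apply: coef_measurable_char_poly => i j.
  under eq_fun do rewrite mxE; apply: measurable_sum => l.
  by apply: measurable_funM => //; under eq_fun do rewrite mxE; exact: mA.
have ms (f : T -> bool) b : measurable_fun setT f -> measurable [set w | f w = b :> bool].
  by move=> mf; have := mf measurableT [set b]; rewrite setTI; exact.
rewrite (_ : [set w | _] = ~` (\bigcap_(i in [set: 'I_n.+1])
    [set w | 0 <= (q w)`_i] `&` [set w | 0 < (q w)`_0])); last first.
  apply/seteqP; split => w /=; rewrite leNgt singular_value_ltE// -/(q w).
    move=> /negP; apply: contra_not => -[h1 h2]; apply/andP; split => //.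
    by apply/forallP => i; exact: h1.
  move=> h; apply/negP => /andP[/forallP h1 h2]; apply: h; split => // i _.
  exact: h1.
apply: measurableC; apply: measurableI.
  apply: fin_bigcap_measurable; first exact: finite_finset.
  by move=> i _; apply: ms; apply: measurable_fun_ler => //; exact: mq.
by apply: ms; apply: measurable_fun_ltr => //; exact: mq.
Qed.

End measurable_singular_value.

(** * Rounding the entries *)

Lemma measurable_bool_set d (T : measurableType d) (f : T -> bool) b :
  measurable_fun setT f -> measurable [set w | f w = b].
Proof. by move=> mf; have := mf measurableT [set b]; rewrite setTI; exact. Qed.

Section cells.
Context {R : realType} (N Z : nat).
Hypothesis N0 : (0 < N)%N.

(** The cell of x records the sign of x and the integral part of N |x|, replaced by
    Z if it is larger.  Rounding the modulus downwards makes every moment of the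
    rounded entry smaller than that of the entry. *)
Definition cell_of (x : R) : 'I_Z.+1 * bool :=
  (inord (minn (Num.truncn (`|x| * N%:R)) Z), 0 <= x).

Definition cell_val (v : 'I_Z.+1 * bool) : R := (-1) ^+ (~~ v.2) * (v.1%:R / N%:R).

Lemma measurable_cell v : measurable [set x | cell_of x = v].
Proof.
case: v => k b.
pose f (x : R) := [&& k%:R <= `|x| * N%:R,
  (Z <= k)%N || (`|x| * N%:R < k.+1%:R) & (if b then 0 <= x else x < 0)].
rewrite (_ : [set x | _] = [set x | f x = true]).
  apply: measurable_bool_set.
  have mN : measurable_fun setT (fun x : R => `|x| * N%:R).
    apply: measurable_funM => //; exact: measurable_normr.
  apply: measurable_and; first exact: measurable_fun_ler.
  apply: measurable_and.
    by apply: measurable_or => //; exact: measurable_fun_ltr.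
  by case: (b); [exact: measurable_fun_ler|exact: measurable_fun_ltr].
apply/seteqP; split => x /=; rewrite /f /cell_of.
  move=> [<- <-]; rewrite inordK ?ltnS ?geq_minr//.
  rewrite (_ : (if _ then _ else _) = true) ?andbT; last by case: leP.
  rewrite -truncn_le_nat -truncn_ge_nat ?mulr_ge0// geq_minl/=.
  by rewrite !leq_min !leqnn andbT leq_total.
move=> /and3P[h1 h2 h3]; congr pair; last by case: (b) h3; case: leP.

apply/val_inj; rewrite /= inordK ?ltnS ?geq_minr//.
rewrite -truncn_ge_nat ?mulr_ge0// in h1; rewrite -truncn_le_nat in h2.
by apply/eqP; rewrite eqn_leq geq_min orbC h2 leq_min h1 -[(k <= Z)%N]ltnS ltn_ord.
Qed.

Lemma cell_val_le v : `|cell_val v| <= Z%:R / N%:R.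
Proof.
rewrite normrM normrX normrN1 expr1n mul1r ger0_norm ?divr_ge0//.
by rewrite ler_wpM2r ?invr_ge0// ler_nat -ltnS ltn_ord.
Qed.

Lemma norm_cell_val_cell x : `|cell_val (cell_of x)| <= `|x|.
Proof.
rewrite normrM normrX normrN1 expr1n mul1r ger0_norm ?divr_ge0//=.
rewrite inordK ?ltnS ?geq_minr// ler_pdivrMr ?ltr0n//.
by rewrite -truncn_ge_nat ?mulr_ge0// geq_minl.
Qed.

Lemma dist_cell_val x : `|x - cell_val (cell_of x)| = `|x| - `|cell_val (cell_of x)|.
Proof.
have := norm_cell_val_cell x.
rewrite /cell_val /=; set y := _ / N%:R; have y0 : 0 <= y by rewrite divr_ge0.
rewrite normrM normrX normrN1 expr1n mul1r (ger0_norm y0).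
have [x0|x0] /= := leP 0 x; rewrite ?expr0 ?expr1 ?mul1r ?mulN1r ?opprK.
  by rewrite (ger0_norm x0) => yx; rewrite ger0_norm ?subr_ge0.
rewrite (ltr0_norm x0) => yx; rewrite ler0_norm; first by rewrite opprD.
by rewrite -[x]opprK addrC subr_le0.
Qed.

Lemma cell_val_close x : `|x| * N%:R < Z.+1%:R ->
  `|x - cell_val (cell_of x)| <= N%:R^-1.
Proof.
move=> xZ; rewrite dist_cell_val /cell_val/=.
rewrite normrM normrX normrN1 expr1n mul1r ger0_norm ?divr_ge0//.
rewrite -truncn_le_nat in xZ.
rewrite inordK ?ltnS ?geq_minr// (minn_idPl xZ).
rewrite lerBlDr -[X in X + _]mul1r -mulrDl ler_pdivlMr ?ltr0n//.
have /andP[_ /ltW] := truncn_itv (mulr_ge0 (normr_ge0 x) (ler0n R N)).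
by rewrite -natr1 addrC.
Qed.

End cells.

Section finite_law.
Context {d : measure_display} {T : measurableType d} {R : realType}.
Variable P : probability T R.
Context {W : finType} (X : {RV P >-> R}) (c : R -> W).
Hypothesis mc : forall v, measurable [set x | c x = v].

Definition law v : R := fine (P (X @^-1` [set x | c x = v])).

Let mX v : measurable (X @^-1` [set x | c x = v]).
Proof.
by rewrite -[X in measurable X]setTI; apply: (measurable_funP X) => //; exact: mc.
Qed.

Lemma law_ge0 v : 0 <= law v.
Proof. exact: fine_ge0. Qed.

Lemma lawE v : (law v)%:E = P (X @^-1` [set x | c x = v]).
Proof. by rewrite /law fineK// fin_num_measure. Qed.

Let cellsE (f : W -> R) w :
  f (c (X w)) = \sum_v f v * \1_(X @^-1` [set x | c x = v]) w.
Proof.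
rewrite (bigD1 (c (X w)))//= big1 ?addr0 => [|v vc].
  by rewrite indicE mem_set//= mulr1.
by rewrite indicE memNset ?mulr0//= => /eqP; rewrite eq_sym (negPf vc).
Qed.

Lemma integrable_cells (f : W -> R) : P.-integrable setT (fun w => (f (c (X w)))%:E).
Proof.
under eq_fun do rewrite cellsE -sumEFin.
apply: integrable_sum => //= v _; under eq_fun do rewrite EFinM.
by apply: integrableZl => //; exact: integrable_indic.
Qed.

Lemma integral_cells (f : W -> R) :
  (\int[P]_w (f (c (X w)))%:E = (\sum_v law v * f v)%:E)%E.
Proof.
under eq_integral do rewrite cellsE -sumEFin.
rewrite integral_sum//; last first.
  move=> v; under eq_fun do rewrite EFinM.
  by apply: integrableZl => //; exact: integrable_indic.
rewrite -sumEFin; apply: eq_bigr => v _.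
under eq_integral do rewrite EFinM.
rewrite integralZl//; last exact: integrable_indic.
by rewrite integral_indic// setIT mulrC EFinM lawE.
Qed.

Lemma law_sum1 : \sum_v law v = 1.
Proof.
apply: EFin_inj; under eq_bigr do rewrite -[law _]mulr1.
rewrite -(integral_cells (fun=> 1)) integral_cst// mul1e.
exact: probability_setT.
Qed.

End finite_law.

(** * Moments of the rounded entries *)

Section cell_moments.
Context {d : measure_display} {T : measurableType d} {R : realType}.
Variable P : probability T R.
Context (X : {RV P >-> R}) (N Z : nat) (r mu : R).
Hypothesis N0 : (0 < N)%N.
Hypothesis r0 : 0 < r.
Hypothesis X1 : ('E_P[X] = 0)%E.
Hypothesis X2 : ('E_P[fun w => (X w ^+ 2)%R] = 1)%E.
Hypothesis Xr : ('E_P[fun w => (`|X w| `^ (1 + r))%R] <= mu%:E)%E.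

Let W : finType := ('I_Z.+1 * bool)%type.
Let c : R -> W := cell_of N Z.
Let a (v : W) : R := cell_val N v.
Let q := law X c.

Let mX : measurable_fun setT (X : T -> R).
Proof. exact: measurable_funP. Qed.

Let mpow : measurable_fun setT (fun w => `|X w| `^ (1 + r)).
Proof.
apply: (measurableT_comp (measurable_powR _)).
exact: measurableT_comp.
Qed.

Let Xr' : (\int[P]_w (`|X w| `^ (1 + r))%:E <= mu%:E)%E.
Proof. by move: Xr; rewrite unlock. Qed.

Lemma cells_second_moment : \sum_v q v * a v ^+ 2 <= 1.
Proof.
rewrite -lee_fin -(integral_cells X (measurable_cell N (Z:=Z)) (fun v => a v ^+ 2)).
move: X2; rewrite unlock => <-.
apply: ge0_le_integral => //.
- by move=> w _; rewrite lee_fin sqr_ge0.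
- have /integrableP[] := integrable_cells X (measurable_cell N (Z:=Z)) (fun v => a v ^+ 2).
  by [].
- by apply/measurable_EFinP; apply: measurable_funX.
move=> w _; rewrite lee_fin -real_normK ?num_real// -[leRHS]real_normK ?num_real//.
by rewrite lerXn2r ?nnegrE// norm_cell_val_cell.
Qed.

(** Beyond L, the first power is dominated by the moment of order 1 + r. *)
Lemma norm_le_pow (L x : R) : 0 < L -> L < `|x| ->
  `|x| <= L `^ (- r) * `|x| `^ (1 + r).
Proof.
move=> L0 Lx; have x0 : 0 < `|x| := lt_trans L0 Lx.
rewrite powRN mulrC ler_pdivlMr ?powR_gt0// powRD; last by rewrite gt_eqF// ltr_wpDl ?ler01.
rewrite powRr1// ler_wpM2l// ge0_ler_powR ?nnegrE ?ltW//.
Qed.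

Lemma pow_integral_le (f : T -> R) (k : R) : 0 <= k -> measurable_fun setT f ->
  (forall w, 0 <= f w) -> (forall w, f w <= k * `|X w| `^ (1 + r)) ->
  (\int[P]_w (f w)%:E <= (k * mu)%:E)%E.
Proof.
move=> k0 mf f0 fk.
apply: (@le_trans _ _ (\int[P]_w (k%:E * (`|X w| `^ (1 + r))%:E))%E).
  apply: ge0_le_integral => //.
  - by move=> w _; rewrite lee_fin.
  - exact/measurable_EFinP.
  - by apply: measurable_funeM; exact/measurable_EFinP.
  - by move=> w _; rewrite -EFinM lee_fin.
rewrite ge0_integralZl_EFin//; last exact/measurable_EFinP.
by rewrite EFinM lee_wpmul2l.
Qed.

Lemma tail_probability_le (H : R) : 0 < H ->
  (P [set w | (H < `|X w|)%R] <= (H `^ (- (1 + r)) * mu)%:E)%E.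
Proof.
move=> H0.
have mE : measurable [set w | H < `|X w|].
  apply: (@measurable_bool_set _ _ (fun w => H < `|X w|) true).
  by apply: measurable_fun_ltr => //; exact: measurableT_comp.
rewrite -[X in P X]setIT -(integral_indic P measurableT mE).
apply: pow_integral_le => // [|w]; first by rewrite powR_ge0.
rewrite indicE; case: (boolP (w \in _)) => [|_]; last by rewrite mulr_ge0 ?powR_ge0.
rewrite inE/= => Hw; rewrite powRN mulrC ler_pdivlMr ?powR_gt0// mul1r.
by apply: ge0_ler_powR; rewrite ?nnegrE ?(ltW H0) ?(ltW Hw)// addr_ge0 ?(ltW r0).
Qed.

Lemma cells_tail_le (L : R) : 0 < L ->
  \sum_v q v * (if `|a v| <= L then 0 else `|a v|) <= L `^ (- r) * mu.
Proof.
move=> L0; pose f v := if `|a v| <= L then 0 else `|a v|.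
rewrite -lee_fin -(integral_cells X (measurable_cell N (Z:=Z)) f).
apply: pow_integral_le => [||w|w]; first by rewrite powR_ge0.
- apply/measurable_EFinP.
  by have /integrableP[] := integrable_cells X (measurable_cell N (Z:=Z)) f.
- by rewrite /f; case: ifP.
rewrite /f; case: ifPn => [_|]; first by rewrite mulr_ge0 ?powR_ge0.
rewrite -ltNge => La.
have h := norm_cell_val_cell Z N0 (X w).
by rewrite (le_trans h)// norm_le_pow// (lt_le_trans La).
Qed.

(** X itself has mean zero, and differs from its truncated rounding by at most 1/N
    when |X| <= L and by at most |X| otherwise. *)
Lemma cells_mean_le (L : R) : 0 < L -> L * N%:R < Z.+1%:R ->
  `|\sum_v q v * (if `|a v| <= L then a v else 0)| <= N%:R^-1 + L `^ (- r) * mu.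
Proof.
move=> L0 LZ; pose f v := if `|a v| <= L then a v else 0.
have iX : P.-integrable setT (fun w => (X w)%:E).
  have i2 : P.-integrable setT (fun w => (1 + X w ^+ 2)%:E).
    under eq_fun do rewrite EFinD.
    apply: integrableD => //; first exact: finite_measure_integrable_cst.
    apply/integrableP; split; first by apply/measurable_EFinP; apply: measurable_funX.
    under eq_integral do rewrite /= ger0_norm ?sqr_ge0//.
    by move: X2; rewrite unlock => ->; rewrite ltry.
  apply: le_integrable i2 => //; first exact/measurable_EFinP.
  move=> w _ /=; rewrite lee_fin [leRHS]ger0_norm; last by rewrite addr_ge0// sqr_ge0.
  rewrite -[X w ^+ 2]real_normK ?num_real//.
  by have := sqr_ge0 (`|X w| - 1); have := normr_ge0 (X w); nra.
have if_ := integrable_cells X (measurable_cell N (Z:=Z)) f.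
have intX : (\int[P]_w (X w)%:E = 0)%E by move: X1; rewrite unlock.
rewrite -lee_fin -abse_EFin -(integral_cells X (measurable_cell N (Z:=Z)) f).
rewrite -[X in `|X|%E]sube0 -intX -integralB//.
apply: (le_trans (le_abse_integral _ _ _)) => //.
  by apply: emeasurable_funB; [case/integrableP: if_|case/integrableP: iX].
apply: (@le_trans _ _ (\int[P]_w ((N%:R^-1)%:E + (L `^ (- r) * `|X w| `^ (1 + r))%:E))%E).
  apply: ge0_le_integral => //.
  - apply: measurableT_comp => //.
    by apply: emeasurable_funB; [case/integrableP: if_|case/integrableP: iX].
  - apply: emeasurable_funD => //; apply/measurable_EFinP.
    by apply: measurable_funM.
  move=> w _; rewrite -EFinB -EFinD abse_EFin lee_fin distrC.
  have h := norm_cell_val_cell Z N0 (X w).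
  have N1 : 0 <= N%:R^-1 :> R by rewrite invr_ge0.
  have t0 : 0 <= L `^ (- r) * `|X w| `^ (1 + r) by rewrite mulr_ge0 ?powR_ge0.
  have [XL|LX] := leP `|X w| L.
    rewrite /f ifT; last exact: le_trans XL.
    rewrite ler_wpDr// cell_val_close// (le_lt_trans _ LZ)// ler_wpM2r//.
  rewrite ler_wpDl// (le_trans _ (norm_le_pow L0 LX))// /f.
  case: ifP => _; last by rewrite subr0.
  by rewrite dist_cell_val// gerBl.
rewrite ge0_integralD//; last 2 first.
- by move=> w _; rewrite lee_fin mulr_ge0 ?powR_ge0.
- by apply/measurable_EFinP; apply: measurable_funM.
rewrite integral_cst// [X in (_ * X)%E](_ : _ = 1%E); last exact: probability_setT.
rewrite mule1 EFinD leeD2l//; apply: pow_integral_le => //.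
- by rewrite powR_ge0.
- by apply: measurable_funM.
- by move=> w; rewrite mulr_ge0 ?powR_ge0.
Qed.

End cell_moments.

(** * The joint law of the rounded entries *)

Lemma sigma_family_bigcap d (T : measurableType d) (R : realType)
    (P : probability T R) (I : finType) (Y : I -> {RV P >-> R}) (D : set I)
    (B : I -> set R) : (forall i, measurable (B i)) ->
  sigma_family Y (\bigcap_(i in D) Y i @^-1` B i).
Proof.
move=> mB; rewrite /sigma_family; set G := [set E | _].
apply: (@fin_bigcap_measurable _ (g_sigma_algebraType G)); first exact: finite_finset.
by move=> i _; apply: sub_sigma_algebra; exists i, (B i).
Qed.

Lemma measure_bigsetU_le d (T : measurableType d) (R : realType)
    (P : {measure set T -> \bar R}) (I : Type) (r : seq I) (D : pred I)
    (F : I -> set T) : (forall i, measurable (F i)) ->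
  (P (\big[setU/set0]_(i <- r | D i) F i) <= \sum_(i <- r | D i) P (F i))%E.
Proof.
move=> mF; elim: r => [|i r IH]; first by rewrite !big_nil measure0.
rewrite !big_cons; case: ifP => // _.
apply: le_trans (measureU2 _ _ _) _ => //; first exact: bigsetU_measurable.
exact: leeD2l.
Qed.

Section joint_law.
Context {d : measure_display} {T : measurableType d} {R : realType}.
Variable P : probability T R.
Context (N n : nat) (p : R) (X xi : 'I_N * 'I_n -> {RV P >-> R}).
Hypothesis hX : sparse_entries p X xi.
Context (W : finType) (c : R -> W).
Hypothesis mc : forall v, measurable [set x | c x = v].

(** A variable with values in {0, 1} is the indicator of the event that it is 1. *)
Lemma P_xi1 i : P (xi i @^-1` [set y | (y == 1) = true]) = p%:E.
Proof.
rewrite -(xi_mean hX i) unlock -[X in P X]setIT -integral_indic//; last first.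
  rewrite -[X in measurable X]setTI; apply: (measurable_funP (xi i)) => //.
  by apply: measurable_bool_set; exact: measurable_fun_eqr.
apply: eq_integral => w _; rewrite indicE; congr (_%:E).
have [xi0|xi1] := xi_01 hX i w.
  by rewrite memNset ?xi0//= xi0 eq_sym oner_eq0.
by rewrite mem_set ?xi1//= xi1 eqxx.
Qed.

Lemma p_ge0_le1 (i : 'I_N * 'I_n) : 0 <= p <= 1.
Proof.
have := P_xi1 i; set A := _ @^-1` _ => h.
have mA : measurable A.
  rewrite -[A]setTI; apply: (measurable_funP (xi i)) => //.
  by apply: measurable_bool_set; exact: measurable_fun_eqr.
have := probability_le1 P mA; have : (0 <= P A)%E by [].
by rewrite h !lee_fin => -> ->.
Qed.

Variable i0 : 'I_N * 'I_n.

Definition entry_law (ev : bool * W) : R :=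
  (if ev.1 then p else 1 - p) * law (X i0) c ev.2.

Lemma entry_law_ge0 ev : 0 <= entry_law ev.
Proof.
have /andP[p0 p1] := p_ge0_le1 i0.
by rewrite /entry_law mulr_ge0 ?law_ge0//; case: ifP => // _; rewrite subr_ge0.
Qed.

Lemma sum_entry_law f : \sum_ev entry_law ev * f ev =
  \sum_v law (X i0) c v * (p * f (true, v) + (1 - p) * f (false, v)).
Proof.
rewrite sum_pairE big_bool/= -big_split/=; apply: eq_bigr => v _.
by rewrite /entry_law/=; ring.
Qed.

Lemma entry_law_sum1 : \sum_ev entry_law ev = 1.
Proof.
under eq_bigr do rewrite -[entry_law _]mulr1.
rewrite (sum_entry_law (fun=> 1)) -[RHS](law_sum1 (X i0) mc).
by apply: eq_bigr => v _; ring.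
Qed.

Definition cell_array (w : T) : {ffun 'I_N * 'I_n -> bool * W} :=
  [ffun i => (xi i w == 1, c (X i w))].

Lemma cell_arrayE u : [set w | cell_array w = u] =
  (\bigcap_(i in [set i | i \in [set: 'I_N * 'I_n]%SET])
     X i @^-1` [set x | c x = (u i).2]) `&`
  (\bigcap_(i in [set i | i \in [set: 'I_N * 'I_n]%SET])
     xi i @^-1` [set y | (y == 1) = (u i).1]).
Proof.
apply/seteqP; split => w /=.
  by move=> <-; split => i _ /=; rewrite /cell_array ffunE.
move=> [h1 h2]; apply/ffunP => i; rewrite /cell_array ffunE.
have iT : i \in [set: 'I_N * 'I_n]%SET by rewrite finset.in_setT.
have /= -> := h1 i iT; have /= -> := h2 i iT.
by case: (u i).
Qed.

Let mxi b : measurable [set y : R | (y == 1) = b].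
Proof. by apply: measurable_bool_set; exact: measurable_fun_eqr. Qed.

Lemma measurable_cell_array u : measurable [set w | cell_array w = u].
Proof.
rewrite cell_arrayE; apply: measurableI.
  apply: fin_bigcap_measurable; first exact: finite_finset.
  move=> i _; rewrite -[X in measurable X]setTI.
  by apply: (measurable_funP (X i)) => //; exact: mc.
apply: fin_bigcap_measurable; first exact: finite_finset.
move=> i _; rewrite -[X in measurable X]setTI.
by apply: (measurable_funP (xi i)) => //; exact: mxi.
Qed.

(** The independence of the two families separates X from xi, and the mutual
    independence inside each family separates the indices. *)
Lemma P_cell_array u : P [set w | cell_array w = u] = (\prod_i entry_law (u i))%:E.
Proof.
rewrite cell_arrayE (X_xi_independent hX); last 2 first.
- by apply: sigma_family_bigcap => i; exact: mc.
- by apply: sigma_family_bigcap => i; exact: mxi.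
rewrite (X_independent hX) => [|i]; last exact: mc.
rewrite (xi_independent hX) => [|i]; last exact: mxi.
rewrite -big_split/= -prodEFin.
apply: eq_big => [i|i _]; first by rewrite finset.in_setT.
rewrite /entry_law EFinM muleC; congr (_ * _)%E.
  case: (u i).1; first exact: P_xi1.
  rewrite (_ : _ @^-1` _ = ~` (xi i @^-1` [set y | (y == 1) = true])).
    rewrite probability_setC ?P_xi1//.
    rewrite -[X in measurable X]setTI.
    by apply: (measurable_funP (xi i)) => //; exact: mxi.
  by apply/seteqP; split => w /=; case: (_ == _).
rewrite lawE//; have := X_identically_distributed hX i i0 (mc (u i).2).
by rewrite /distribution /pushforward.
Qed.

Lemma P_cell_array_le (E : pred {ffun 'I_N * 'I_n -> bool * W}) :
  measurable [set w | E (cell_array w)] /\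
  (P [set w | E (cell_array w)] <= (Pr entry_law E)%:E)%E.
Proof.
have -> : [set w | E (cell_array w)] =
    \big[setU/set0]_(u | E u) [set w | cell_array w = u].
  apply/seteqP; split => w /=.
    move=> Ew; rewrite -bigcup_seq_cond/=; exists (cell_array w) => //=.
    by rewrite mem_index_enum.
  by rewrite -bigcup_seq_cond => -[u /= /andP[_ Eu] ->].
split; first by apply: bigsetU_measurable => u _; exact: measurable_cell_array.
apply: le_trans (measure_bigsetU_le _ _ _ (@measurable_cell_array)) _.
rewrite (eq_bigr (fun u : {ffun 'I_N * 'I_n -> bool * W} => (\prod_i entry_law (u i))%:E)); last first.
  by move=> u _; exact: P_cell_array.
rewrite sumEFin lee_fin /Pr /Ex [leLHS]big_mkcond/= le_eqVlt; apply/orP; left; apply/eqP.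
by apply: eq_bigr => u _; case: (E u); rewrite ?mulr1 ?mulr0.
Qed.

End joint_law.

(** On the event where no entry of X exceeds H, the rounded array differs from the
    sparse matrix by at most 1/N in each entry, hence by at most 1 <= s in norm.
    The remaining hypotheses are the numerical relations between the truncation
    levels H and L, the parameter lam of the exponential moments and the sparsity
    m that make every union bound succeed. *)
Lemma sparse_matrix_norm d (T : measurableType d) (R : realType)
    (P : probability T R) (N n : nat) (p : R)
    (X xi : 'I_N * 'I_n -> {RV P >-> R}) (r mu H L m lam M s : R) :
  (2 <= N)%N -> (1 <= n < N)%N -> sparse_entries p X xi ->
  0 < r -> 0 <= mu ->
  (forall i, ('E_P[fun w => (`|X i w| `^ (1 + r))%R] <= mu%:E)%E) ->
  0 < p -> 1 <= s -> s ^+ 2 = N%:R * p ->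
  0 < L -> L <= H -> ln N%:R * H <= s ->
  p * (1 + N%:R * (L `^ (- r) * mu)) <= s ->
  0 <= lam -> 0 <= M -> 12 * (2 * M + 1) * lam * (2 * L) ^+ 2 <= 1 ->
  3 * expR (3 - M) <= lam * p ->
  1 <= m -> m <= N%:R -> 6 * m * ln N%:R <= lam * p * N%:R ->
  4 * L * N%:R <= m * s ->
  (P [set w | (77 * s <= (singular_values (sparse_matrix X xi w))`_0)%R] <=
   (5 * expR (4 - ln N%:R) + N%:R ^+ 2 * (H `^ (- (1 + r)) * mu))%R%:E)%E.
Proof.
move=> N2 /andP[n1 nN] hX r0 mu0 Xr p0 s1 s2 L0 LH lnH tail lam0 M0 lamL eM m1 mN mlam light.
have N0 : (0 < N)%N by exact: ltn_trans N2.
have N0' : 0 < N%:R :> R by rewrite ltr0n.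
have H0 : 0 < H := lt_le_trans L0 LH.
have s0 : 0 < s by lra.
pose i0 : 'I_N * 'I_n := (Ordinal N0, Ordinal n1).
pose Z := Num.truncn (H * N%:R).
pose c := cell_of N Z : R -> _.
have mc := measurable_cell N (Z := Z) (R := R).
pose a (ev : bool * ('I_Z.+1 * bool)) : R := if ev.1 then cell_val N ev.2 else 0.
pose q := entry_law p X c i0.
have q0 : forall ev, 0 <= q ev := entry_law_ge0 hX c i0.
have q1 : \sum_ev q ev = 1 := entry_law_sum1 p X mc i0.
have ZH : Z%:R / N%:R <= H.
  by rewrite ler_pdivrMr// truncn_le mulr_ge0 ?ltW.
have aH ev : `|a ev| <= H.
  rewrite /a; case: ifP => _; last by rewrite normr0 ltW.
  exact: le_trans (cell_val_le _ _) ZH.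
have a2 : \sum_ev q ev * a ev ^+ 2 <= p.
  rewrite (sum_entry_law p X c i0 (fun ev => a ev ^+ 2)) /a/=.
  rewrite (eq_bigr (fun v => p * (law (X i0) c v * cell_val N v ^+ 2))); last first.
    by move=> v _; rewrite expr0n/=; ring.
  rewrite -mulr_sumr ler_piMr ?(ltW p0)//.
  exact: (cells_second_moment Z N0 (X_second_moment hX i0)).
have LZ : L * N%:R < Z.+1%:R.
  by rewrite (le_lt_trans _ (truncnS_gt _))// ler_wpM2r.
have atail : N%:R * (\sum_ev q ev * (if `|a ev| <= L then 0 else `|a ev|)) <= s.
  rewrite (sum_entry_law p X c i0 (fun ev => if `|a ev| <= L then 0 else `|a ev|)).
  rewrite /a/= normr0 (ltW L0).
  rewrite (eq_bigr (fun v => p * (law (X i0) c v *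
    (if `|cell_val N v| <= L then 0 else `|cell_val N v|)))); last first.
    by move=> v _; rewrite mulr0 addr0 mulrCA.
  rewrite -mulr_sumr (le_trans _ tail)// mulrCA ler_wpM2l ?(ltW p0)//.
  rewrite ler_wpDl// ler_wpM2l ?(ltW N0')//.
  exact: (cells_tail_le Z N0 r0 (Xr i0) L0).
have amean : N%:R * `|\sum_ev q ev * (if `|a ev| <= L then a ev else 0)| <= s.
  rewrite (sum_entry_law p X c i0 (fun ev => if `|a ev| <= L then a ev else 0)).
  rewrite /a/= normr0 (ltW L0).
  rewrite (eq_bigr (fun v => p * (law (X i0) c v *
    (if `|cell_val N v| <= L then cell_val N v else 0)))); last first.
    by move=> v _; rewrite mulr0 addr0 mulrCA.
  rewrite -mulr_sumr normrM (gtr0_norm p0) (le_trans _ tail)// mulrCA.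
  rewrite ler_wpM2l ?(ltW p0)//.
  rewrite -[X in _ <= X + _](divff (_ : N%:R != 0 :> R)) ?gt_eqF// -mulrDr.
  rewrite ler_wpM2l ?(ltW N0')//.
  exact: (cells_mean_le N0 r0 (X_mean hX i0) (X_second_moment hX i0) (Xr i0) L0 LZ).
have cI : (#|{: 'I_N}| <= N)%N by rewrite card_ord.
have cJ : (#|{: 'I_n}| <= N)%N by rewrite card_ord ltnW.
have [E [PE hE]] := discrete_bform_le q0 q1 N2 cI cJ p0 s0 s2 a2 H0 aH lnH atail amean
  L0 lam0 M0 lamL eM m1 mN mlam light.
have [mE PE'] := P_cell_array_le hX mc i0 E.
pose F := \big[setU/set0]_(i : 'I_N * 'I_n) [set w | (H < `|X i w|)%R].
have mF i : measurable [set w | (H < `|X i w|)%R].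
  apply: (@measurable_bool_set _ _ (fun w => H < `|X i w|) true).
  by apply: measurable_fun_ltr => //; apply: measurableT_comp => //; exact: measurable_funP.
have PF : (P F <= (N%:R ^+ 2 * (H `^ (- (1 + r)) * mu))%:E)%E.
  apply: (le_trans (measure_bigsetU_le _ _ _ mF)).
  apply: (@le_trans _ _ (\sum_(i : 'I_N * 'I_n) (H `^ (- (1 + r)) * mu)%:E)%E).
    by apply: lee_sum => i _; exact: tail_probability_le.
  rewrite sumEFin lee_fin sumr_const -[leLHS]mulr_natl ler_wpM2r ?mulr_ge0 ?powR_ge0//.
  by rewrite card_prod !card_ord natrM expr2 ler_wpM2l// ler_nat ltnW.
have sub : [set w | (77 * s <= (singular_values (sparse_matrix X xi w))`_0)%R] `<=`
    [set w | E (cell_array X xi c w)] `|` F.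
  move=> w /= sv; apply: contrapT => /not_orP[/negP wE wF].
  have XH i : `|X i w| <= H.
    rewrite leNgt; apply/negP => HX; apply: wF; rewrite /F -bigcup_seq/=.
    by exists i => //=; rewrite mem_index_enum.
  suff : (singular_values (sparse_matrix X xi w))`_0 <= 76 * s.
    by move=> h; have := le_trans sv h; lra.
  apply: singular_value_le => //; first by rewrite mulr_ge0// ltW.
  move=> x y x1 y1.
  pose A i j := a (cell_array X xi c w (i, j)).
  pose B i j := sparse_matrix X xi w i j - A i j.
  have -> : bform x (sparse_matrix X xi w) y = bform x A y + bform x B y.
    rewrite -bform_addm; apply: eq_bigr => i _; apply: eq_bigr => j _.
    by rewrite /B addrC subrK.
  have hB : bform x B y <= 1.
    have Bij i j : `|B i j| <= N%:R^-1.
      rewrite /B /A /a mxE/= ffunE/=.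
      have [->|->] := xi_01 hX (i, j) w.
        by rewrite eq_sym oner_eq0 mul0r subr0 normr0 invr_ge0.
      rewrite eqxx mul1r cell_val_close//.
      by rewrite (le_lt_trans _ (truncnS_gt _))// ler_wpM2r.
    apply: bform_schur => // [i|j].
      apply: (@le_trans _ _ (\sum_(j < n) N%:R^-1)); first exact: ler_sum.
      by rewrite sumr_const card_ord -[leLHS]mulr_natl ler_pdivrMr// mul1r ler_nat ltnW.
    apply: (@le_trans _ _ (\sum_(i < N) N%:R^-1)); first exact: ler_sum.
    by rewrite sumr_const card_ord -[leLHS]mulr_natl divff// gt_eqF.
  have := hE _ wE x y x1 y1; rewrite -/A => hA.
  rewrite -/(bform x A y) in hA.
  lra.
have mF' : measurable F by apply: bigsetU_measurable => i _; exact: mF.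
apply: (@le_trans _ _ (P ([set w | E (cell_array X xi c w)] `|` F))).
  apply: le_measure sub; rewrite inE; last exact: measurableU.
  apply: measurable_singular_value => //; first by rewrite mulr_ge0// ltW.
  move=> i j; under eq_fun do rewrite mxE.
  by apply: measurable_funM; exact: measurable_funP.
apply: (le_trans (measureU2 _ _ _)) => //.
rewrite EFinD leeD// (le_trans PE')// lee_fin.
Qed.

(** * Choice of the truncation levels *)

(** Apply ln t < t to a small power t of N. *)
Lemma ln_powR_le (R : realType) (a k c : R) : 0 < a -> 0 <= k -> 0 < c ->
  exists N0 : nat, forall N : nat, (N0 <= N)%N -> (1 <= N)%N ->
    c * ln N%:R `^ k <= N%:R `^ a.
Proof.
move=> a0 k0 c0.
have k1 : 0 < k + 1 by rewrite ltr_wpDl.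
pose b := a / (k + 1); have b0 : 0 < b by rewrite divr_gt0.
exists (Num.truncn ((c * b^-1 `^ k) `^ b^-1)).+1 => N NN N1.
have N0' : 0 < N%:R :> R by rewrite ltr0n.
pose t := N%:R `^ b; have t0 : 0 < t by rewrite powR_gt0.
have ct : c * b^-1 `^ k <= t.
  rewrite -[leLHS]powRr1 ?mulr_ge0 ?powR_ge0 ?(ltW c0)//.
  rewrite -(mulVf (_ : b != 0)) ?gt_eqF// powRrM ge0_ler_powR ?nnegrE ?powR_ge0 ?(ltW b0)//.
  by rewrite (le_trans (ltW (truncnS_gt _)))// ler_nat.
have lt : ln N%:R <= b^-1 * t.
  by rewrite ler_pdivlMl// -ln_powR ltW// ln_sublinear.
have -> : N%:R `^ a = t * t `^ k.
  rewrite -[X in X * _]powRr1 ?(ltW t0)// -powRD; last by rewrite (gt_eqF t0) implybT.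
  rewrite /t -powRrM (addrC 1) /b mulfVK ?gt_eqF//.
apply: (@le_trans _ _ (c * (b^-1 * t) `^ k)).
  rewrite ler_wpM2l ?(ltW c0)// ge0_ler_powR ?nnegrE ?ln_ge0 ?ler1n//.
  by rewrite mulr_ge0 ?invr_ge0 ?ltW.
rewrite powRM ?invr_ge0 ?(ltW b0) ?(ltW t0)// mulrA ler_wpM2r ?powR_ge0//.
Qed.

(** G = N^(d / 20) stands for the small power of N that absorbs the logarithms.  The
    last two estimates use the moment beyond the fourth: with 4 moments only, the
    exponents of N in N L^(-3) and in N^2 H^(-4) would exceed those of sqrt N and of
    1 by a multiple of dd. *)
Lemma truncation_levels (R : realType) (N : nat) (delta d : R) (dd := d / 20)
    (G := N%:R `^ dd) (S := Num.sqrt N%:R) (H := S / G) (L := H `^ (3^-1)) :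
  (2 <= N)%N -> 0 < d -> d <= 1 -> d <= delta ->
  [/\ [/\ 1 <= L, 1 <= G & 1 <= H], L <= H /\ L ^+ 2 <= H, L ^+ 3 = H,
      N%:R * L `^ (- (3 + delta)) <= S / G ^+ 2 &
      N%:R ^+ 2 * H `^ (- (4 + delta)) <= G^-1].
Proof.
move=> N2 d0 d1 ddelta.
have N1 : 1 <= N%:R :> R by rewrite ler1n ltnW.
have N0 : 0 < N%:R :> R by exact: lt_le_trans N1.
have Nne : N%:R != 0 :> R by rewrite gt_eqF.
have SE : S = N%:R `^ 2^-1 by rewrite powR12_sqrt// ltW.
have powB x y : N%:R `^ x / N%:R `^ y = N%:R `^ (x - y) :> R.
  by rewrite powRB// Nne implybT.
have powD x y : N%:R `^ x * N%:R `^ y = N%:R `^ (x + y) :> R.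
  by rewrite powRD// Nne implybT.
have G1 : 1 <= G by rewrite -[leLHS](powRr0 N%:R) ler_powR// /dd; lra.
have HE : H = N%:R `^ (2^-1 - dd) by rewrite /H SE powB.
have H1 : 1 <= H by rewrite HE -[leLHS](powRr0 N%:R) ler_powR// /dd; lra.
have H0 : 0 < H by exact: lt_le_trans H1.
have LE : L = N%:R `^ ((2^-1 - dd) / 3) by rewrite /L HE -powRrM.
have L0 : 0 < L by rewrite powR_gt0.
have pown k : L ^+ k = H `^ (k%:R / 3).
  by rewrite -powR_mulrn ?ltW// /L -powRrM mulrC.
split.
- by split=> //; rewrite -[leLHS](powRr0 H) ler_powR//; lra.
- split; first by rewrite /L -[leRHS]powRr1 ?(ltW H0)// ler_powR//; lra.
  by rewrite pown -[leRHS]powRr1 ?(ltW H0)// ler_powR//; lra.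
- by rewrite pown divff// powRr1// ltW.
- rewrite SE (_ : G ^+ 2 = N%:R `^ (2 * dd)); last first.
    by rewrite -powR_mulrn ?powR_ge0// /G -powRrM mulrC.
  rewrite powB -[X in X * _]powRr1 ?(ltW N0)// LE -powRrM powD ler_powR//.
  rewrite /dd; nra.
- rewrite -powR_mulrn ?(ltW N0)// HE -powRrM powD /G -powRN ler_powR//.
  rewrite /dd; nra.
Qed.

(** The parameters: M = 2 ln N makes exp (- M) negligible, lam is then the largest
    value that keeps the exponential moments sub-Gaussian, and m the largest
    sparsity whose grid is beaten.  The inequality between l^10 and G is what the
    vectors with small coordinates require of m; l^10 collects l^2 from the
    parameters and l^8 from p^2 >= B^2 / l^8. *)
Lemma sparse_matrix_norm_large dT (T : measurableType dT) (R : realType)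
    (P : probability T R) (N n : nat) (p : R)
    (X xi : 'I_N * 'I_n -> {RV P >-> R}) (delta d mu B l G : R) :
  (2 <= N)%N -> (1 <= n < N)%N -> sparse_entries p X xi ->
  0 < mu ->
  (forall i, ('E_P[fun w => (`|X i w| `^ (4 + delta))%R] <= mu%:E)%E) ->
  0 < d -> d <= 1 -> d <= delta -> 0 < B ->
  l = ln N%:R -> G = N%:R `^ (d / 20) ->
  B / l ^+ 4 <= p -> 1 <= l -> 2 <= Num.sqrt N%:R :> R ->
  2 * mu <= G -> 80 ^+ 2 * l ^+ 10 <= B ^+ 2 * G -> l ^+ 6 <= B * G ->
  720 * expR 3 * l ^+ 5 <= B * G ->
  (P [set w | (77 * Num.sqrt (N%:R * p) <=
               (singular_values (sparse_matrix X xi w))`_0)%R] <=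
   ((5 * expR 4 + mu) / G)%:E)%E.
Proof.
move=> N2 n1N hX mu0 Xmom d0 d1 dd B0 lE GE lp l1 S2 muG hl10 hl6 hl5.
have [[]] := truncation_levels N2 d0 d1 dd; rewrite -GE.
set S := Num.sqrt _ in S2 *; set H := S / G; set L := H `^ _.
move=> L1 G1 H1 [LH L2H] L3 Lr Hr.
have N1 : 1 <= N%:R :> R by rewrite ler1n ltnW.
have N0 : 0 < N%:R :> R by exact: lt_le_trans N1.
have l0 : 0 < l := lt_le_trans ltr01 l1.
have l40 : 0 < l ^+ 4 by rewrite exprn_gt0.
have L0 : 0 < L := lt_le_trans ltr01 L1.
have G0 : 0 < G := lt_le_trans ltr01 G1.
have S1 : 1 <= S by rewrite (le_trans _ S2)// ler1n.
have S0 : 0 < S := lt_le_trans ltr01 S1.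
have SS : S ^+ 2 = N%:R by rewrite sqr_sqrtr// ltW.
have lp4 : B <= p * l ^+ 4 by rewrite -ler_pdivrMr.
have p0 : 0 < p by rewrite -(pmulr_lgt0 _ l40) (lt_le_trans B0 lp4).
have p1 : p <= 1.
  have /andP[n0 nN] := n1N.
  by have /andP[] := p_ge0_le1 hX (Ordinal (ltn_trans n0 nN), Ordinal n0).
pose u := Num.sqrt p.
have u0 : 0 < u by rewrite sqrtr_gt0.
have uu : u ^+ 2 = p by rewrite sqr_sqrtr// ltW.
have u1 : u <= 1 by rewrite -(@ler_pXn2r _ 2) ?nnegrE ?(ltW u0)// expr1n uu.
have pu : p <= u by rewrite -uu expr2 ler_piMl// ltW.
have sE : Num.sqrt (N%:R * p) = S * u by rewrite sqrtrM// ltW.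
have HG : H * G = S by rewrite /H mulfVK ?gt_eqF.
have H0 : 0 < H := lt_le_trans ltr01 H1.
have GS : G <= S by rewrite -HG ler_peMl// ltW.
have HS : H <= S by rewrite -HG ler_peMr// ltW.
have SN : S <= N%:R by rewrite -SS expr2 ler_peMl// ltW.
pose M := 2 * l.
pose lam := (48 * L ^+ 2 * (2 * M + 1))^-1.
have M1 : 0 < 2 * M + 1 by rewrite addr_gt0// !mulr_gt0.
have LL1 : 1 <= L ^+ 2 by rewrite exprn_ege1.
have lam_den : 0 < 48 * L ^+ 2 * (2 * M + 1) by rewrite !mulr_gt0// (lt_le_trans ltr01 LL1).
have lam0 : 0 < lam by rewrite invr_gt0.
have M5 : 2 * M + 1 <= 5 * l by move: l1; rewrite /M; clear; lra.
pose m := lam * p * N%:R / (6 * l).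
have bound := @sparse_matrix_norm _ _ _ P N n p X xi (3 + delta) mu H L m lam M
  (Num.sqrt (N%:R * p)) N2 n1N hX.
have GG : G <= G ^+ 2 by rewrite expr2 ler_peMl// ltW.
have lG : l ^+ 2 <= p * G ^+ 2.
  rewrite -(ler_pM2r l40) -exprD (le_trans hl6)// [leRHS]mulrAC.
  by rewrite ler_pM// ltW.
have lH : l * H <= S * u.
  rewrite -(@ler_pXn2r _ 2) ?nnegrE ?(ltW (mulr_gt0 _ _))// exprMn.
  apply: (@le_trans _ _ (p * G ^+ 2 * H ^+ 2)); first by rewrite ler_wpM2r ?sqr_ge0.
  by rewrite -uu -HG le_eqVlt; apply/orP; left; apply/eqP; ring.
have s1 : 1 <= S * u by rewrite (le_trans _ lH)// (le_trans H1)// ler_peMl// ltW.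
have ms : 4 * L * N%:R <= m * (S * u).
  have h1 : 1152 * l * (2 * M + 1) <= p * u * G.
    apply: (@le_trans _ _ (80 ^+ 2 * l ^+ 2)).
      by have := ler_wpM2l (ltW l0) M5; have := sqr_ge0 l; rewrite expr2; clear; lra.
    apply: (@le_trans _ _ (p ^+ 2 * G)); last first.
      by rewrite ler_wpM2r ?(ltW G0)// expr2 ler_wpM2l// ltW.
    rewrite -(ler_pM2r (exprn_gt0 8 l0)) -mulrA -exprD (le_trans hl10)// [leRHS]mulrAC.
    rewrite ler_wpM2r ?(ltW G0)// (_ : l ^+ 8 = (l ^+ 4) ^+ 2); last by rewrite -exprM.
    by rewrite -exprMn lerXn2r ?nnegrE ?(ltW B0) ?(ltW (mulr_gt0 p0 l40)).
  have -> : m * (S * u) = (p * u * G) * (N%:R * H) / (288 * L ^+ 2 * l * (2 * M + 1)).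
    rewrite /m /lam -HG; field.
    by rewrite !gt_eqF.
  have D0 : (0 : R) < 288 by rewrite ltr0n.
  rewrite ler_pdivlMr; last first.
    exact: (mulr_gt0 (mulr_gt0 (mulr_gt0 D0 (lt_le_trans ltr01 LL1)) l0) M1).
  have -> : 4 * L * N%:R * (288 * L ^+ 2 * l * (2 * M + 1)) =
      (1152 * l * (2 * M + 1)) * (N%:R * L ^+ 3) by ring.
  by rewrite L3 ler_wpM2r// mulr_ge0 ?ltW.
have S0u : 0 < S * u by rewrite mulr_gt0.
have SuN : S * u <= N%:R by rewrite (le_trans _ SN)// ler_piMr// ltW.
have m1 : 1 <= m.
  rewrite -(ler_pM2r S0u) mul1r (le_trans SuN)// (le_trans _ ms)//.
  rewrite ler_peMl ?(ltW N0)// (le_trans L1)// ler_peMl ?(ltW L0)// ler1n//.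
have expM : expR (3 - M) = expR 3 / N%:R ^+ 2.
  have -> : M = ln N%:R + ln N%:R by rewrite /M lE; ring.
  by rewrite expRB expRD lnK ?posrE// expr2.
apply: (le_trans (bound _ _ _ _ _ _ _ _ _ _ _ _ _ _ _ _ _ _)) => //.
- by rewrite addr_gt0// (lt_le_trans d0).
- exact: ltW.
- by move=> i; rewrite (_ : 1 + (3 + delta) = 4 + delta)//; ring.
- by rewrite sE.
- by rewrite sqr_sqrtr// mulr_ge0 ?ltW.
- by rewrite -lE sE.
- rewrite sE.
  have h1 : N%:R * (L `^ (- (3 + delta)) * mu) <= S / 2.
    rewrite mulrA (le_trans (ler_wpM2r (ltW mu0) Lr))// mulrAC ler_pdivrMr ?exprn_gt0//.
    by rewrite -mulrA ler_wpM2l ?(ltW S0)//; move: muG GG; clear; lra.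
  apply: (@le_trans _ _ (p * S)).
    by rewrite ler_wpM2l ?(ltW p0)//; move: h1 S2; clear; lra.
  by rewrite mulrC ler_wpM2l// ltW.
- exact: ltW.
- by rewrite mulr_ge0// ltW.
- rewrite le_eqVlt; apply/orP; left; apply/eqP; rewrite /lam; field.
  by rewrite !gt_eqF.
- rewrite expM mulrA ler_pdivrMr ?exprn_gt0//.
  have -> : lam * p * N%:R ^+ 2 = p * N%:R ^+ 2 / (48 * L ^+ 2 * (2 * M + 1)).
    by rewrite /lam -mulrA mulrC.
  rewrite ler_pdivlMr//.
  rewrite -(ler_pM2r l40).
  apply: (@le_trans _ _ (720 * expR 3 * l ^+ 5 * N%:R)).
    have -> : 3 * expR 3 * (48 * L ^+ 2 * (2 * M + 1)) * l ^+ 4 =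
      144 * expR 3 * l ^+ 4 * (L ^+ 2 * (2 * M + 1)) by ring.
    have -> : 720 * expR 3 * l ^+ 5 * N%:R =
      144 * expR 3 * l ^+ 4 * (N%:R * (5 * l)) by ring.
    apply: ler_wpM2l; first exact: (mulr_ge0 (mulr_ge0 (ler0n _ _) (expR_ge0 _)) (ltW l40)).
    by rewrite ler_pM ?sqr_ge0 ?(ltW M1)// (le_trans L2H)// (le_trans HS).
  apply: (@le_trans _ _ (B * G * N%:R)); first by rewrite ler_wpM2r// ltW.
  have -> : p * N%:R ^+ 2 * l ^+ 4 = p * l ^+ 4 * N%:R * N%:R by ring.
  rewrite ler_wpM2r ?(ltW N0)// ler_pM ?(ltW B0) ?(ltW G0)//.
  exact: le_trans SN.
- rewrite /m ler_pdivrMr; last by rewrite mulr_gt0.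
  rewrite [leRHS]mulrC ler_wpM2r ?(ltW N0)//.
  apply: (@le_trans _ _ 1); last by move: l1; clear; lra.
  rewrite mulr_ile1 ?(ltW lam0) ?(ltW p0)// invf_le1//.
  rewrite -[leLHS]mulr1 ler_pM//; last by move: l1; rewrite /M; clear; lra.
  by move: LL1; clear; lra.
- rewrite -lE le_eqVlt; apply/orP; left; apply/eqP; rewrite /m; field.
  by rewrite gt_eqF.
- by rewrite sE.
rewrite lee_fin [leRHS]mulrDl; apply: lerD.
  rewrite expRD expRN lnK ?posrE// mulrA ler_wpM2l ?mulr_ge0 ?expR_ge0//.
  by rewrite lef_pV2 ?posrE// (le_trans GS).
rewrite mulrA mulrC ler_wpM2l ?(ltW mu0)//.
by rewrite (_ : 1 + (3 + delta) = 4 + delta)//; ring.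
Qed.

(** * The bound for every N *)

Theorem corollary1p4 (R : realType)
    (n : nat -> nat) (y0 : R)
    (hn : forall N : nat, (2 <= N)%N -> (1 <= n N < N)%N)
    (hy0 : 0 < y0 < 1)
    (hny0 : (n N)%:R / N%:R @[N --> \oo] --> y0)
    (d : nat -> measure_display)
    (T : forall N : nat, measurableType (d N))
    (P : forall N : nat, probability (T N) R)
    (p : nat -> R)
    (X xi : forall N : nat, 'I_N * 'I_(n N) -> {RV (P N) >-> R})
    (hX : forall N : nat, (2 <= N)%N -> sparse_entries (p N) (X N) (xi N))
    (delta mu : R) (hdelta : 0 < delta) (hmu : 0 < mu)
    (hmoment : forall N : nat, (2 <= N)%N -> forall i : 'I_N * 'I_(n N),
       ('E_(P N)[fun w => (`|X N i w| `^ (4 + delta))%R] <= mu%:E)%E)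
    (B : R) (hB : 0 < B)
    (hNp : let kappa := delta / (2 * (4 + delta)) in
       forall N : nat, (2 <= N)%N ->
         B * ln N%:R `^ (3 / (2 * kappa)) <= N%:R * p N)
    (B' : R) (hB' : 0 < B')
    (hp : forall N : nat, (2 <= N)%N -> B' / ln N%:R ^+ 4 <= p N)
    (Q : R) (hQ : 1 <= Q) :
  exists K C : R, forall N : nat, (2 <= N)%N ->
    (P N [set w | (K * Num.sqrt (N%:R * p N) <=
                  (singular_values (sparse_matrix (X N) (xi N) w))`_0)%R]
     <= (C * N%:R `^ (- Q) + C / ln N%:R `^ delta)%R%:E)%E.
Proof.
pose dd := Num.min delta 1.
have dd0 : 0 < dd by rewrite lt_min hdelta ltr01.
have dd1 : dd <= 1 by rewrite ge_min lexx orbT.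
have ddd : dd <= delta by rewrite ge_min lexx.
have a0 : 0 < dd / 20 by rewrite divr_gt0.
pose c1 := 80 ^+ 2 / B' ^+ 2; pose c2 := B'^-1; pose c3 := 720 * expR 3 / B'.
have c10 : 0 < c1 by rewrite divr_gt0 ?exprn_gt0.
have c20 : 0 < c2 by rewrite invr_gt0.
have c30 : 0 < c3.
  have p720 : (0 : R) < 720 by rewrite ltr0n.
  exact: (divr_gt0 (mulr_gt0 p720 (expR_gt0 3)) hB').
pose c := c1 + c2 + c3 + 2 * mu.
have c0 : 0 < c by rewrite !addr_gt0// mulr_gt0.
have [N1 hN1] := ln_powR_le a0 (ler0n R 10) c0.
have [N2 hN2] := ln_powR_le a0 (ltW hdelta) ltr01.
pose N0 := maxn (maxn N1 N2) (maxn 4 (Num.truncn (expR 1 : R)).+1).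
pose A := 5 * expR 4 + mu.
have A0 : 0 < A.
  have p5 : (0 : R) < 5 by rewrite ltr0n.
  exact: (addr_gt0 (mulr_gt0 p5 (expR_gt0 4)) hmu).
(* The first term makes the bound trivial below N0, the second one serves from N0
   on. *)
pose C := ln N0%:R `^ delta + A.
have C0 : 0 < C by rewrite ltr_wpDl ?powR_ge0.
exists 77, C => N NN2.
have N1' : 1 < N%:R :> R by rewrite ltr1n.
have l0 : 0 < ln N%:R :> R by rewrite ln_gt0.
have ld0 : 0 < ln N%:R `^ delta :> R by rewrite powR_gt0.
apply: (@le_trans _ _ (C / ln N%:R `^ delta)%:E); last first.
  by rewrite lee_fin lerDr mulr_ge0 ?powR_ge0// ltW.
have n0 : (0 < n N)%N by have /andP[] := hn N NN2.
have [NN0|NN0] := ltnP N N0.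
  apply: (@le_trans _ _ 1%:E).
    apply: probability_le1; apply: measurable_singular_value => //.
    move=> i j; under eq_fun do rewrite mxE.
    by apply: measurable_funM; exact: measurable_funP.
  rewrite lee_fin ler_pdivlMr// mul1r (@le_trans _ _ (ln N0%:R `^ delta))//.
    have lNN0 : ln N%:R <= ln N0%:R :> R.
      rewrite ler_ln ?posrE ?ltr0n ?ler_nat ?(ltnW NN0)//; first exact: ltnW NN2.
      exact: leq_ltn_trans NN0.
    apply: ge0_ler_powR => //; first exact: ltW.
      by rewrite nnegrE ltW.
    by rewrite nnegrE (le_trans _ lNN0)// ltW.
  by rewrite lerDl ltW.
move: NN0; rewrite !geq_max => /andP[/andP[NN1 NN2'] /andP[N4 Ne]].
have {}hN1 := hN1 N NN1 (ltnW NN2); have {}hN2 := hN2 N NN2' (ltnW NN2).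
rewrite powR_mulrn ?(ltW l0)// in hN1; rewrite mul1r in hN2.
set l := ln N%:R in l0 ld0 hN1 hN2 *; set G := N%:R `^ (dd / 20) in hN1 hN2.
have l1 : 1 <= l.
  rewrite -ler_expR lnK ?posrE ?(lt_trans _ N1')//.
  by rewrite (le_trans (ltW (truncnS_gt _)))// ler_nat.
have G0 : 0 < G by exact: lt_le_trans hN2.
have l10 k : (k <= 10)%N -> l ^+ k <= l ^+ 10 by move=> k10; exact: ler_weXn2l.
have l100 : 0 <= l ^+ 10 by rewrite exprn_ge0 ?ltW.
have cG c' k : 0 <= c' -> c' <= c -> (k <= 10)%N -> c' * l ^+ k <= G.
  move=> c'0 c'c /l10 lk; apply: le_trans hN1; apply: ler_pM => //.
  exact: exprn_ge0 (ltW l0).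
have := @sparse_matrix_norm_large _ (T N) R (P N) N (n N) (p N) (X N) (xi N) delta
  dd mu B' l G NN2 (hn N NN2) (hX N NN2) hmu (hmoment N NN2) dd0 dd1 ddd hB' erefl erefl
  (hp N NN2) l1.
move=> bound; apply: (le_trans (bound _ _ _ _ _)).
- rewrite -[leLHS]ger0_norm// -sqrtr_sqr ler_wsqrtr// -natrX ler_nat//.
- rewrite -[leLHS]mulr1 -(expr0 l) cG// ?mulr_ge0 ?(ltW hmu)//.
  by move: c10 c20 c30; rewrite /c; clear; lra.
- rewrite -ler_pdivrMl ?exprn_gt0// mulrA (mulrC _ (80 ^+ 2)).
  by rewrite (cG c1) ?(ltW c10)//; move: c20 c30 hmu; rewrite /c; clear; lra.
- rewrite -ler_pdivrMl//.
  by rewrite (cG c2) ?(ltW c20)//; move: c10 c30 hmu; rewrite /c; clear; lra.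
- rewrite -ler_pdivrMl// mulrA (mulrC _ (720 * expR 3)).
  by rewrite (cG c3) ?(ltW c30)//; move: c10 c20 hmu; rewrite /c; clear; lra.
rewrite lee_fin -/A ler_pM ?(ltW A0) ?invr_ge0 ?(ltW G0)//.
  by rewrite /C lerDr powR_ge0.
by rewrite lef_pV2 ?posrE.
Qed.
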